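(* Let $\mathfrak{H}$ be a separable complex Hilbert space, let $\alpha\in[0,\pi/4]$, and let $A$ be an $m$-sectorial operator in $\mathfrak{H}$ with semi-angle $\alpha$ and with vertex at $z=0$. Then $\{e^{-tA}\}_{t\geq 0}$ is a quasi-sectorial contraction semigroup with numerical ranges $\mathfrak{N}(e^{-tA})\subseteq D_{\alpha}$ for all $t\geq 0$. (That is, for every $t\ge 0$ the operator $e^{-tA}$ is a contraction and $(u,e^{-tA}u)\in D_\alpha$ for every unit vector $u\in\mathfrak{H}$.)
   Context: Throughout, $(\cdot,\cdot)$ is the inner product of $\mathfrak{H}$, linear in the second argument. For a densely defined linear operator $T$ with domain $\mathrm{dom}(T)\subset\mathfrak{H}$, the numerical range is $$\mathfrak{N}(T):=\{(u,Tu)\in\mathbb{C}: u\in\mathrm{dom}(T),\ \|u\|=1\}.$$ For $\alpha\in[0,\pi/2)$ let $S_\alpha:=\{z\in\mathbb{C}:|\arg z|\le\alpha\}$ (with $0\in S_\alpha$; in particular $S_0=[0,\infty)$). A densely defined operator $T$ is called sectorial with semi-angle $\alpha$ and vertex at $z=0$ if $\mathfrak{N}(T)\subseteq S_\alpha$. If, in addition, $T$ is closed and there is some $z\in\mathbb{C}\setminus S_\alpha$ belonging to the resolvent set $\rho(T)$, then $T$ is called $m$-sectorial with semi-angle $\alpha$ and vertex at $z=0$. For $\alpha\in[0,\pi/2)$ define the closed domain $$D_\alpha:=\{z\in\mathbb{C}:|z|\le\sin\alpha\}\cup\{z\in\mathbb{C}:|\arg(1-z)|\le\alpha\ \text{and}\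 |z-1|\le\cos\alpha\},$$ where the point $z=1$ is included in the second set. A contraction $C$ on $\mathfrak{H}$ (a bounded operator with $\|C\|\le1$) is called quasi-sectorial with semi-angle $\alpha\in[0,\pi/2)$ with respect to the vertex at $z=1$ if $\mathfrak{N}(C)\subseteq D_\alpha$. $\{e^{-tA}\}_{t\ge0}$ denotes the strongly continuous semigroup on $\mathfrak{H}$ whose infinitesimal generator, in the standard sign convention, is $-A$. *)

(* Defs.v *)
From HB Require Import structures.
From mathcomp Require Import all_boot all_order all_algebra.
From mathcomp Require Import sesquilinear complex.
From mathcomp Require Import all_classical all_reals all_analysis.

Set Implicit Arguments.
Unset Strict Implicit.
Unset Printing Implicit Defensive.
Import Order.TTheory GRing.Theory Num.Theory.
Import numFieldNormedType.Exports.

Local Open Scope classical_set_scope.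
Local Open Scope ring_scope.
Local Open Scope complex_scope.

Section ComplexPlane.
Context {R : realType}.
Implicit Types (z : R[i]) (alpha : R).

(* Principal argument, with values in ]-pi, pi] for z != 0 (see cargP).
   At z = 0 the value is irrelevant: 0 is treated separately below. *)
Definition carg z : R :=
  let theta := acos (complex.Re z / complex.Re `|z|) in
  if 0 <= complex.Im z then theta else - theta.

Lemma cargP z : z != 0 ->
  [/\ - pi < carg z, carg z <= pi
    & z = `|z| * (cos (carg z) +i* sin (carg z))].
Proof.
case: z => x y z0; rewrite /carg normc_def /=.
set n := Num.sqrt (x ^+ 2 + y ^+ 2).
have xy0 : 0 < x ^+ 2 + y ^+ 2.
  rewrite lt0r addr_ge0 ?sqr_ge0// andbT paddr_eq0 ?sqr_ge0// !sqrf_eq0.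
  by apply: contra z0 => /andP[/eqP -> /eqP ->].
have n0 : 0 < n by rewrite sqrtr_gt0.
have n2 : n ^+ 2 = x ^+ 2 + y ^+ 2 by rewrite sqr_sqrtr// ltW.
have c2 : 1 - (x / n) ^+ 2 = (y / n) ^+ 2.
  apply: (mulIf (lt0r_neq0 (exprn_gt0 2 n0))).
  by rewrite mulrBl mul1r !expr_div_n !divfK ?sqrf_eq0 ?lt0r_neq0// n2 addrC addKr.
have c1 : -1 <= x / n <= 1.
  rewrite -ler_norml -(@ler_pXn2r _ 2)// ?nnegrE// expr1n real_normK ?num_real//.
  by rewrite -subr_ge0 c2 sqr_ge0.
have [a0 api] := (acos_ge0 c1, acos_lepi c1).
have sa : sin (acos (x / n)) = `|y| / n.
  by rewrite sin_acos// c2 sqrtr_sqr normrM (gtr0_norm (_ : 0 < n^-1)) ?invr_gt0.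
have nK u : n * (u / n) = u by rewrite mulrC divfK ?lt0r_neq0.
have [y0|y0] := leP 0 y; split => //.
- by apply: lt_le_trans a0; rewrite oppr_lt0 pi_gt0.
- by apply/eqP; rewrite eq_complex /= !mul0r subr0 addr0 acosK ?in_itv//= sa ger0_norm// !nK !eqxx.
- rewrite ltrN2 acos_ltpi//; case/andP: c1 => c1 ->; rewrite andbT lt_neqAle c1 andbT.
  apply/eqP => c1E; move: c2; rewrite -c1E sqrrN expr1n subrr => /esym/eqP.
  by rewrite sqrf_eq0 mulf_eq0 invr_eq0 (lt_eqF y0) gt_eqF.
- by rewrite (le_trans _ (ltW (pi_gt0 R)))// oppr_le0.
- apply/eqP; rewrite eq_complex /= !mul0r subr0 addr0 cosN sinN acosK ?in_itv//= sa.
  by rewrite ltr0_norm// mulNr opprK !nK !eqxx.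
Qed.

Definition sector alpha : set R[i] :=
  [set z | z = 0 \/ `|carg z| <= alpha].

(* [sector alpha (1 - z)] says |arg (1 - z)| <= alpha, with z = 1 included. *)
Definition quasi_sector alpha : set R[i] :=
  [set z | `|z| <= (sin alpha)%:C] `|`
  [set z | sector alpha (1 - z) /\ `|z - 1| <= (cos alpha)%:C].

End ComplexPlane.

Definition separable (T : topologicalType) : Prop :=
  exists2 S : set T, countable S & dense S.

Section Operators.
Context {R : realType} {H : completeNormedModType R[i]}.

(* The values of [op_fun] outside [op_dom] carry no meaning. *)
Record operator := Operator {
  op_dom : set H;
  op_fun :> H -> H;
  op_dom0 : op_dom 0;
  op_domP : forall a x y, op_dom x -> op_dom y -> op_dom (a *: x + y);
  op_linear : forall a x y, op_dom x -> op_dom y ->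
    op_fun (a *: x + y) = a *: op_fun x + op_fun y }.

Program Definition opp_op (T : operator) : operator :=
  @Operator (op_dom T) (fun x => - T x) _ _ _.
Next Obligation. by move=> T; exact: op_dom0. Qed.
Next Obligation. by move=> T a x y; exact: op_domP. Qed.
Next Obligation.
by move=> T a x y Tx Ty /=; rewrite op_linear// opprD scalerN.
Qed.

Program Definition everywhere_op (C : {linear H -> H}) : operator :=
  @Operator setT C _ _ _.
Next Obligation. by []. Qed.
Next Obligation. by []. Qed.
Next Obligation. by move=> C a x y _ _; rewrite linearP. Qed.

Definition densely_defined (T : operator) : Prop := dense (op_dom T).

Definition op_graph (T : operator) : set (H * H) :=
  [set p | op_dom T p.1 /\ p.2 = T p.1].

Definition closed_op (T : operator) : Prop := closed (op_graph T).

Definition bounded_op (C : {linear H -> H}) : Prop :=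
  exists M : R, forall x, `|C x| <= M%:C * `|x|.

Definition resolvent_set (T : operator) : set R[i] :=
  [set z | exists S : {linear H -> H}, [/\ bounded_op S,
     forall y, op_dom T (S y) /\ z *: S y - T (S y) = y
   & forall x, op_dom T x -> S (z *: x - T x) = x]].

Definition contraction (C : {linear H -> H}) : Prop :=
  forall x, `|C x| <= `|x|.

(* Only the operators U t with t >= 0 are relevant. *)
Definition C0_semigroup (U : R -> {linear H -> H}) : Prop :=
  [/\ forall t : R, 0 <= t -> bounded_op (U t),
      forall x, U 0 x = x,
      forall (s t : R) x, 0 <= s -> 0 <= t -> U (s + t) x = U s (U t x)
    & forall x, {within `[0, +oo[%classic, continuous (fun t : R => U t x)}].

(* Equality of G with the infinitesimal generator of U, domains included. *)
Definition generates (G : operator) (U : R -> {linear H -> H}) : Prop :=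
  forall x y, op_graph G (x, y) <->
    ((h^-1)%:C *: (U h x - x) @[h --> (0 : R)^'+] --> y).

(* [dot] is linear in the first argument and conjugate-linear in the second;
   [inner dot] is the inner product linear in its second argument. *)
Section InnerProduct.
Variable dot : {dot H for Num.conj}.

Definition inner (u v : H) : R[i] := dot v u.

(* The norm of H is the one induced by the inner product. *)
Definition hilbert_norm : Prop := forall u, `|u| ^+ 2 = inner u u.

Definition numerical_range (T : operator) : set R[i] :=
  [set inner u (T u) | u in [set u | op_dom T u /\ `|u| = 1]].

Definition sectorial (alpha : R) (T : operator) : Prop :=
  densely_defined T /\ numerical_range T `<=` sector alpha.

Definition m_sectorial (alpha : R) (T : operator) : Prop :=
  [/\ sectorial alpha T, closed_op T
    & exists2 z, ~ sector alpha z & resolvent_set T z].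

Definition quasi_sectorial_contraction (alpha : R) (C : {linear H -> H}) :=
  contraction C /\ numerical_range (everywhere_op C) `<=` quasi_sector alpha.

End InnerProduct.
End Operators.
Arguments operator {R} H.

(* Main.v *)
From HB Require Import structures.
Require Import Defs.
From mathcomp Require Import all_boot all_order all_algebra.
From mathcomp Require Import sesquilinear complex.
From mathcomp Require Import all_classical all_reals all_analysis.
From mathcomp Require Import ring lra.
Import Order.TTheory GRing.Theory Num.Theory.
Import numFieldNormedType.Exports.
Local Open Scope ring_scope.
Local Open Scope complex_scope.

(* Only the half-planes Re (e z) <= max (Re e, sin alpha), e on the unit circle,
   matter: they cut out D_alpha, the convex hull of 1 and of the disc of radius
   sin alpha.  For alpha <= pi / 4 the resolvents (1 + t A)^-1 satisfy these
   support inequalities, because both their numerical range and its image under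
   z |-> 1 - z lie in the sector.  The inequalities pass from C to C^2: if
   y1 = (a + C) x and y2 = (a - C) x, then
     2 conj(a) (x, (a^2 - C^2) x) = (y1, (a - C) y1) + (y2, (a + C) y2),
   so a half-plane for C^2 follows from two opposite half-planes for C, for a
   suitable a.  Hence they hold for the dyadic Euler approximants
   (1 + t A / 2^n)^-(2^n).  On the domain of A^2 these converge geometrically,
   since replacing a step of length s + t by steps of length s and t costs at
   most s t |A^2 x|; the limit is a contraction semigroup generated by - A, and
   it is the only C0 semigroup with that generator. *)

(** * The real-valued norm *)

Section Norm.
Set Implicit Arguments.
Unset Strict Implicit.
Local Open Scope classical_set_scope.
Local Open Scope ring_scope.
Context {R : realType} {H : completeNormedModType R[i]}.
Implicit Types (x y z : H) (a : R[i]).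

(** The norm of [H] is [R[i]]-valued; [nrm] moves all estimates to the totally ordered field [R]. *)
Definition nrm x : R := complex.Re `|x|.

Lemma nrmE x : `|x| = (nrm x)%:C.
Proof. by rewrite /nrm RRe_real// ger0_real. Qed.

Lemma nrm_le x y : (`|x| <= `|y|) = (nrm x <= nrm y).
Proof. by rewrite !nrmE lecR. Qed.

Lemma nrm_ge0 x : 0 <= nrm x.
Proof. by rewrite -lecR -nrmE normr_ge0. Qed.

Lemma nrm0 : nrm (0 : H) = 0.
Proof. by rewrite /nrm normr0. Qed.

Lemma nrm0_eq0 x : nrm x = 0 -> x = 0.
Proof. by move=> x0; apply: normr0_eq0; rewrite nrmE x0. Qed.

Lemma nrmN x : nrm (- x) = nrm x.
Proof. by rewrite /nrm normrN. Qed.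

Lemma nrmC x y : nrm (x - y) = nrm (y - x).
Proof. by rewrite -nrmN opprB. Qed.

Lemma nrmD x y : nrm (x + y) <= nrm x + nrm y.
Proof. by have := ler_normD x y; rewrite !nrmE -rmorphD lecR. Qed.

Lemma nrm_triangle z x y : nrm (x - y) <= nrm (x - z) + nrm (z - y).
Proof. by rewrite -[x - y](subrKA z) nrmD. Qed.

Lemma nrm_subr x y : nrm x - nrm y <= nrm (x - y).
Proof. by rewrite lerBlDr -{1}(subrK y x) nrmD. Qed.

Lemma nrmZ a x : nrm (a *: x) = complex.Re `|a| * nrm x.
Proof.
have := normrZ a x; rewrite !nrmE -{1}(RRe_real (ger0_real (normr_ge0 a))).
by rewrite -rmorphM => /complexI.
Qed.

Lemma nrmZr (r : R) x : nrm (r%:C *: x) = `|r| * nrm x.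
Proof. by rewrite nrmZ normc_def/= expr0n/= addr0 sqrtr_sqr. Qed.

Lemma nrm_unit x : x != 0 -> nrm ((nrm x)^-1%:C *: x) = 1.
Proof.
move=> x0; rewrite nrmZr ger0_norm ?invr_ge0 ?nrm_ge0// mulVf//.
by apply: contra x0 => /eqP/nrm0_eq0 ->.
Qed.

Lemma nrm_cvgP {T : Type} {F : set_system T} {FF : Filter F} (f : T -> H) l :
  (f t @[t --> F] --> l)%classic <->
  forall e : R, 0 < e -> \forall t \near F, nrm (f t - l) < e.
Proof.
split=> [/cvgrPdist_lt fl e e0|fl].
  have := fl e%:C; rewrite ltcR => /(_ e0); apply: filterS => t.
  by rewrite nrmE ltcR nrmC.
apply/cvgrPdist_lt => e e0.
have eE : e = (complex.Re e)%:C by rewrite RRe_real// gtr0_real.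
have := fl (complex.Re e); rewrite -ltcR -eE => /(_ e0); apply: filterS => t.
by rewrite nrmE eE ltcR nrmC.
Qed.

Lemma dense_nrm (S : set H) x (e : R) :
  dense S -> 0 < e -> exists2 y, S y & nrm (y - x) < e.
Proof.
move=> dS e0; have e0' : 0 < e%:C by rewrite ltcR.
have [] := dS (ball x e%:C).
- by exists x; exact: ballxx.
- exact: ball_open.
move=> y; rewrite -ball_normE => -[/=]; rewrite nrmE ltcR => xy Sy.
by exists y => //; rewrite nrmC.
Qed.

Lemma half_pow_gt0 n : 0 < (2^-1 : R) ^+ n.
Proof. by rewrite exprn_gt0// invr_gt0. Qed.

Lemma half_pow_small (C e : R) : 0 < e -> \forall n \near \oo, C * 2^-1 ^+ n < e.
Proof.
move=> e0; have half1 : `|2^-1 : R| < 1 by rewrite gtr0_norm; lra.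
have /cvgrPdist_lt/(_ e e0) := cvg_geometric C half1.
apply: filterS => n; rewrite /geometric/= sub0r normrN.
by apply: le_lt_trans; exact: ler_norm.
Qed.

(** Telescoping. The subtracted power makes the induction exact, since
    [C 2^-k = 2 C (2^-k - 2^-(k+1))]. *)
Lemma geometric_tail (x : nat -> H) (C : R) (m n : nat) :
  (forall n, nrm (x n.+1 - x n) <= C * 2^-1 ^+ n) ->
  nrm (x (n + m)%N - x n) <= 2 * C * (2^-1 ^+ n - 2^-1 ^+ (n + m)%N).
Proof.
move=> xC; elim: m => [|m IH]; first by rewrite addn0 !subrr nrm0 mulr0.
rewrite addnS; apply: le_trans (nrm_triangle (x (n + m)%N) _ _) _.
apply: le_trans (lerD (xC _) IH) _.
by rewrite exprS; lra.
Qed.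

Lemma nrm_cauchy_cvg (x : nat -> H) :
  (forall e : R, 0 < e -> exists N, forall n, (N <= n)%N -> nrm (x n - x N) < e) ->
  exists l : H, x n @[n --> \oo] --> l.
Proof.
move=> xC; suff /cauchy_cvgP/cvg_ex[l xl] : cauchy (x n @[n --> \oo]) by exists l.
apply: cauchy_exP => e e0.
have eE : e = (complex.Re e)%:C by rewrite RRe_real// gtr0_real.
have e0' : 0 < complex.Re e by rewrite -ltcR -eE.
have [N NP] := xC _ e0'.
exists (x N), N => // n /= Nn; rewrite -ball_normE /= nrmE eE ltcR nrmC.
exact: NP.
Qed.

Lemma nrm_cvg_le (x : nat -> H) l y (B : R) :
  x n @[n --> \oo] --> l -> (forall n, nrm (x n - y) <= B) -> nrm (l - y) <= B.
Proof.
move=> /nrm_cvgP xl xB; apply/ler_addgt0Pr => e e0.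
have [N _ /(_ N (leqnn N))/= NP] := xl e e0.
apply: le_trans (nrm_triangle (x N) _ _) _; rewrite addrC lerD//.
by rewrite nrmC ltW.
Qed.

Lemma geometric_cvg (x : nat -> H) (C : R) :
  (forall n, nrm (x n.+1 - x n) <= C * 2^-1 ^+ n) ->
  exists2 l : H, x n @[n --> \oo] --> l & forall n, nrm (x n - l) <= 2 * C * 2^-1 ^+ n.
Proof.
move=> xC.
have C0 : 0 <= C by have := le_trans (nrm_ge0 _) (xC 0%N); rewrite expr0 mulr1.
have tail m n : nrm (x (n + m)%N - x n) <= 2 * C * 2^-1 ^+ n.
  apply: le_trans (geometric_tail m n xC) _.
  by apply: ler_wpM2l; [lra|rewrite gerBl ltW// half_pow_gt0].
have [e e0|l xl] := @nrm_cauchy_cvg x.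
  have [N _ NP] := half_pow_small (2 * C) e0; exists N => n Nn.
  by rewrite -(subnKC Nn); apply: le_lt_trans (tail _ _) (NP _ _) => /=.
exists l => // n; rewrite nrmC; apply: (@nrm_cvg_le (fun m => x (m + n)%N)).
  by rewrite (cvg_shiftn n x).
by move=> m; rewrite addnC.
Qed.

Lemma nrm_small_eq x y : (forall e : R, 0 < e -> nrm (x - y) <= e) -> x = y.
Proof.
move=> xy; apply/eqP; rewrite -subr_eq0; apply/eqP/nrm0_eq0/eqP.
rewrite eq_le nrm_ge0 andbT; apply/ler_addgt0Pr => e e0.
by rewrite add0r xy.
Qed.

Lemma nrm_cvg_unique (x : nat -> H) (l l' : H) :
  x n @[n --> \oo] --> l -> x n @[n --> \oo] --> l' -> l = l'.
Proof. by move=> xl xl'; apply: cvg_unique xl xl'; exact: norm_hausdorff. Qed.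

End Norm.

(** * Inner product and resolvents of accretive operators *)

Section InnerProduct.
Set Implicit Arguments.
Unset Strict Implicit.
Context {R : realType} {H : completeNormedModType R[i]}.
Variable dot : {dot H for Num.conj}.
Hypothesis hdot : hilbert_norm dot.
Implicit Types (u v w : H) (a : R[i]).
Local Notation ip := (inner dot).

Lemma innerDr u v w : ip u (v + w) = ip u v + ip u w.
Proof. exact: linearDl. Qed.

Lemma innerZr a u v : ip u (a *: v) = a * ip u v.
Proof. exact: linearZl. Qed.

Lemma innerC u v : ip v u = (ip u v)^*%C.
Proof. by rewrite /inner hermC expr0 mul1r. Qed.

Lemma innerDl u v w : ip (u + v) w = ip u w + ip v w.
Proof. by rewrite innerC innerDr (innerC w u) (innerC w v) -rmorphD. Qed.

Lemma innerZl a u v : ip (a *: u) v = a^*%C * ip u v.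
Proof. by rewrite innerC innerZr (innerC v u) -rmorphM. Qed.

Lemma innerNr u v : ip u (- v) = - ip u v.
Proof. by rewrite -scaleN1r innerZr mulN1r. Qed.

Lemma inner_nrm u : ip u u = (nrm u ^+ 2)%:C.
Proof. by rewrite -hdot nrmE rmorphXn. Qed.

Lemma nrmD_sqr u v :
  nrm (u + v) ^+ 2 = nrm u ^+ 2 + 2 * complex.Re (ip u v) + nrm v ^+ 2.
Proof.
have := inner_nrm (u + v).
rewrite innerDl !innerDr !inner_nrm (innerC u v).
case: (ip u v) => x y /= [<- _]; lra.
Qed.

(** Cauchy-Schwarz for the real part, read off from the triangle inequality for [u + v] by squaring
    and expanding. *)
Lemma inner_le u v : complex.Re (ip u v) <= nrm u * nrm v.
Proof.
have : nrm (u + v) ^+ 2 <= (nrm u + nrm v) ^+ 2.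
  by rewrite ler_pXn2r ?nnegrE ?nrm_ge0 ?addr_ge0 ?nrm_ge0// nrmD.
rewrite nrmD_sqr sqrrD; lra.
Qed.

Lemma Re_mul_inner_le a u v :
  complex.Re (a * ip u v) <= complex.Re `|a| * (nrm u * nrm v).
Proof. by rewrite -innerZr mulrCA -nrmZ inner_le. Qed.

End InnerProduct.

Section Resolvent.
Set Implicit Arguments.
Unset Strict Implicit.
Context {R : realType} {H : completeNormedModType R[i]}.
Variable dot : {dot H for Num.conj}.
Hypothesis hdot : hilbert_norm dot.
Local Notation ip := (inner dot).
Variables (A : operator H) (e : R[i]).
Hypothesis eA : forall u, op_dom A u -> 0 <= complex.Re (e * ip u (A u)).

(** The range half of [z] being in the resolvent set; where [Re (e z) < 0], the control of the
    inverse comes from [accretive_lower_bound]. *)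
Definition shift_onto (z : R[i]) : Prop :=
  forall y, exists2 x, op_dom A x & z *: x - A x = y.

(** Pair [z u - A u] with [u] and multiply by [- e]: the [A] term is nonnegative by [eA], and
    Cauchy-Schwarz bounds the whole by [|e| |u| |z u - A u|]. *)
Lemma accretive_lower_bound (z : R[i]) u : op_dom A u ->
  - complex.Re (e * z) * nrm u <= complex.Re `|e| * nrm (z *: u - A u).
Proof.
move=> Au; have [->|u0] := eqVneq u 0.
  by rewrite nrm0 mulr0 mulr_ge0 ?nrm_ge0// normc_def sqrtr_ge0.
have nu0 : 0 < nrm u.
  by rewrite lt_neqAle nrm_ge0 andbT eq_sym; apply: contra u0 => /eqP/nrm0_eq0 ->.
rewrite -(ler_pM2r nu0).
have := Re_mul_inner_le hdot (- e) u (z *: u - A u); rewrite normrN; set n := complex.Re `|e|.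
rewrite innerDr innerNr innerZr (inner_nrm hdot) mulrDr !mulNr mulrN opprK mulrA.
have := eA Au; set c := e * ip u (A u); set d := e * z.
case: c => c1 c2; case: d => d1 d2 /=; rewrite mulr0 subr0.
move: (nrm u) (nrm _) => p q c0.
rewrite expr2; lra.
Qed.

(* One step of the Neumann series: [x = S (y - d x)] is solved by iteration, where [S] inverts [z - A]. *)
Lemma shift_onto_step (z d : R[i]) :
  shift_onto z -> 0 < - complex.Re (e * z) ->
  2 * (complex.Re `|e| * complex.Re `|d|) <= - complex.Re (e * z) ->
  shift_onto (z + d).
Proof.
move=> zA ez0 dz y.
have /choice[S SP] : forall y, exists x, op_dom A x /\ z *: x - A x = y.
  by move=> v; have [x ? ?] := zA v; exists x.
pose x := fix x n := if n is m.+1 then S (y - d *: x m) else 0.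
have AB u v : op_dom A u -> op_dom A v -> op_dom A (u - v) /\ A (u - v) = A u - A v.
  move=> Au Av; have -> : u - v = (-1) *: v + u by rewrite scaleN1r addrC.
  by split; [exact: op_domP|rewrite op_linear// scaleN1r addrC].
(* The lower bound and the smallness [dz] of [d] make [v |-> S (y - d v)] a contraction of ratio
   1/2. *)
have bound u v : op_dom A u -> op_dom A v -> forall k,
    z *: u - A u - (z *: v - A v) = d *: k -> nrm (u - v) <= 2^-1 * nrm k.
  move=> Au Av k E; have [Auv AE] := AB _ _ Au Av.
  have := accretive_lower_bound z Auv.
  have -> : z *: (u - v) - A (u - v) = d *: k.
    by rewrite -E AE scalerBr !opprD addrACA.
  rewrite nrmZ => le1.
  rewrite -(ler_pM2l ez0); apply: le_trans le1 _.
  by have := ler_wpM2r (nrm_ge0 k) dz; lra.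
have xE n : x n.+2 - x n.+1 = S (y - d *: x n.+1) - S (y - d *: x n) by [].
have [S1 S2] : (forall v, op_dom A (S v)) /\ forall v, z *: S v - A (S v) = v.
  by split=> v; have [] := SP v.
have Sbound u v : nrm (S (y - d *: u) - S (y - d *: v)) <= 2^-1 * nrm (v - u).
  apply: bound => //; rewrite !S2 scalerBr opprB.
  by rewrite [LHS]addrC subrKA.
have [l _ lP] : exists2 l, (x n @[n --> \oo] --> l)%classic & forall n,
    nrm (x n - l) <= 2 * nrm (x 1%N - x 0%N) * 2^-1 ^+ n.
  apply: geometric_cvg; elim=> [|n IH]; first by rewrite expr0 mulr1.
  rewrite xE; apply: le_trans (Sbound _ _) _; rewrite nrmC exprS mulrCA.
  by rewrite ler_pM2l ?invr_gt0.
(* A fixed point solves the equation for [z + d], and it lies in the domain because [S] takes its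
   values there. *)
suff lE : S (y - d *: l) = l.
  exists l; first by rewrite -lE.
  by have := S2 (y - d *: l); rewrite lE => E; rewrite scalerDl addrAC E subrK.
apply: nrm_small_eq => r r0.
have [N _ NP] := half_pow_small (2 * nrm (x 1%N - x 0%N)) r0.
apply: le_trans (nrm_triangle (x N.+1) _ _) _.
have := Sbound l (x N); have := lP N; have := lP N.+1; have := NP N (leqnn N).
rewrite /= exprS; lra.
Qed.

(** Continuity method: on the segment from [z] to [w] the quantity [- Re (e .)] stays at least [q],
    so [shift_onto_step] applies along it with one uniform step length. *)
Lemma shift_onto_half_plane (z w : R[i]) : shift_onto z ->
  complex.Re (e * z) < 0 -> complex.Re (e * w) < 0 -> shift_onto w.
Proof.
move=> zA ez0 ew0.
have [q q0 [zq wq]] : exists2 q : R, 0 < q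
    & q <= - complex.Re (e * z) /\ q <= - complex.Re (e * w).
  exists (Num.min (- complex.Re (e * z)) (- complex.Re (e * w))).
    by rewrite lt_min !oppr_gt0 ez0 ew0.
  by split; rewrite ge_min lexx ?orbT.
pose c := 2 * (complex.Re `|e| * complex.Re `|w - z|).
have c0 : 0 <= c by rewrite !mulr_ge0// normc_def/= sqrtr_ge0.
(* With this [N] the increment [(w - z) / N] meets the size condition of [shift_onto_step]
   everywhere on the segment. *)
pose N := Num.bound (c / q).
have cN : c < N%:R * q by rewrite -ltr_pdivrMr// archi_boundP// divr_ge0// ltW.
have N0 : 0 < N%:R :> R.
  by rewrite -(pmulr_lgt0 _ q0); exact: le_lt_trans cN.
have step k : (k <= N)%N -> shift_onto (z + (k%:R / N%:R)%:C * (w - z)).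
  elim: k => [_|k IH kN]; first by rewrite mul0r mul0r addr0.
  rewrite -natr1 mulrDl mul1r rmorphD mulrDl addrA.
  have kN1 : 0 <= (k%:R / N%:R : R) <= 1.
    by rewrite divr_ge0// ler_pdivrMr// mul1r ler_nat ltnW.
  have qle : q <= - complex.Re (e * (z + (k%:R / N%:R)%:C * (w - z))).
    move: kN1 zq wq; rewrite mulrDr mulrCA mulrBr.
    set a := e * z; set b := e * w; case: a b => a1 a2 [b1 b2] /=.
    by rewrite mul0r subr0; move: (_ / _) => t /andP[t0 t1] za wb; nra.
  apply: shift_onto_step (IH (ltnW kN)) _ _; first exact: lt_le_trans qle.
  apply: le_trans qle.
  have -> : complex.Re `|(N%:R^-1)%:C * (w - z)| = N%:R^-1 * complex.Re `|w - z|.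
    by rewrite normrM normc_def/= expr0n addr0 sqrtr_sqr mul0r subr0 gtr0_norm ?invr_gt0.
  rewrite [leLHS](_ : _ = N%:R^-1 * c); last by rewrite /c; ring.
  rewrite ler_pdivrMl// ltW//.
have := step N (leqnn N).
by rewrite divff ?lt0r_neq0// mul1r addrC subrK.
Qed.

End Resolvent.

(** * The implicit Euler scheme *)

Section OperatorAlgebra.
Set Implicit Arguments.
Unset Strict Implicit.
Context {R : realType} {H : completeNormedModType R[i]}.
Variable A : operator H.
Implicit Types x y : H.

Lemma op_dom_add x y : op_dom A x -> op_dom A y -> op_dom A (x + y).
Proof. by rewrite -{2}[x]scale1r; exact: op_domP. Qed.

Lemma op_dom_scale a x : op_dom A x -> op_dom A (a *: x).
Proof. by move=> Ax; rewrite -[_ *: _]addr0; apply: op_domP => //; exact: op_dom0. Qed.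

Lemma op_dom_sub x y : op_dom A x -> op_dom A y -> op_dom A (x - y).
Proof.
by move=> Ax Ay; apply: op_dom_add => //; rewrite -scaleN1r; exact: op_dom_scale.
Qed.

Lemma op_add x y : op_dom A x -> op_dom A y -> A (x + y) = A x + A y.
Proof. by move=> Ax Ay; rewrite -{1}[x]scale1r op_linear// scale1r. Qed.

Lemma op_zero : A 0 = 0.
Proof.
have := op_add (op_dom0 A) (op_dom0 A); rewrite addr0 => /eqP.
by rewrite -subr_eq subrr => /eqP.
Qed.

Lemma op_scale a x : op_dom A x -> A (a *: x) = a *: A x.
Proof.
by move=> Ax; rewrite -[a *: x]addr0 op_linear ?op_zero ?addr0//; exact: op_dom0.
Qed.

Lemma op_sub x y : op_dom A x -> op_dom A y -> A (x - y) = A x - A y.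
Proof.
move=> Ax Ay; rewrite -scaleN1r op_add ?op_scale ?scaleN1r//.
by rewrite -scaleN1r; exact: op_dom_scale.
Qed.

End OperatorAlgebra.

Section Contractions.
Set Implicit Arguments.
Unset Strict Implicit.
Context {R : realType} {H : completeNormedModType R[i]}.

Definition contractive (T : H -> H) := forall x, nrm (T x) <= nrm x.

Lemma iter_contractive (T : H -> H) n : contractive T -> contractive (iter n T).
Proof. by move=> cT x; elim: n => // n IH /=; exact: le_trans (cT _) IH. Qed.

(** [T^(N+1) x - S^(N+1) x] is [T (T^N x - S^N x)] plus the one-step error at [S^N x]; contractivity
    of [T] keeps the earlier errors from growing. *)
Lemma iter_sub_le (T : {linear H -> H}) (S : H -> H) x (M : R) N : contractive T ->
  (forall j, nrm (T (iter j S x) - S (iter j S x)) <= M) ->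
  nrm (iter N T x - iter N S x) <= N%:R * M.
Proof.
move=> cT TS; elim: N => [|N IH]; first by rewrite subrr nrm0 mul0r.
rewrite /= -natr1 mulrDl mul1r.
apply: le_trans (nrm_triangle (T (iter N S x)) _ _) (lerD _ (TS N)).
by rewrite -linearB; exact: le_trans (cT _) IH.
Qed.

(** Strong continuity at 0, to serve both the resolvents and the limit semigroup: approximate [x] by
    [y] in [S], where the rate is linear in [t]; contractivity carries the error over. *)
Lemma contractive_small (S : set H) (T : R -> {linear H -> H}) (N : H -> R) x e :
  dense S -> (forall t, 0 <= t -> contractive (T t)) ->
  (forall t y, 0 <= t -> S y -> nrm (T t y - y) <= t * N y) -> 0 < e ->
  exists2 d, 0 < d & forall t, 0 <= t <= d -> nrm (T t x - x) <= e.
Proof.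
move=> dS cT TN e0; have [|y Sy yx] := @dense_nrm _ _ S x (e / 4) dS.
  by rewrite divr_gt0.
have n0 : 0 < 1 + `|N y| by rewrite ltr_pwDl.
exists (e / 2 / (1 + `|N y|)); first by rewrite !divr_gt0.
move=> t /andP[t0]; rewrite ler_pdivlMr// => te.
have h1 : nrm (T t x - T t y) <= nrm (y - x).
  by rewrite -linearB (nrmC y); exact: cT.
have := nrm_triangle (T t y) (T t x) x; have := nrm_triangle y (T t y) x.
have := TN t y t0 Sy; have := ler_wpM2l t0 (ler_norm (N y)); lra.
Qed.

End Contractions.

Section ImplicitEuler.
Set Implicit Arguments.
Unset Strict Implicit.
Local Open Scope classical_set_scope.
Local Open Scope ring_scope.
Context {R : realType} {H : completeNormedModType R[i]}.
Variable A : operator H.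
(** With [A_onto] this is m-accretivity expressed through the norm alone; no inner product occurs in
    the construction. *)
Hypothesis A_exp : forall (t : R) x, 0 <= t -> op_dom A x ->
  nrm x <= nrm (x + t%:C *: A x).
Hypothesis A_onto : forall (t : R) y, 0 < t ->
  exists2 x, op_dom A x & x + t%:C *: A x = y.
Hypothesis A_dense : dense (op_dom A).

Lemma euler_unique (t : R) x y : 0 <= t -> op_dom A x -> op_dom A y ->
  x + t%:C *: A x = y + t%:C *: A y -> x = y.
Proof.
move=> t0 Ax Ay E; apply/eqP; rewrite -subr_eq0; apply/eqP/nrm0_eq0/eqP.
rewrite eq_le nrm_ge0 andbT; apply: le_trans (A_exp t0 (op_dom_sub Ax Ay)) _.
rewrite op_sub// scalerBr addrACA E addrACA.
by rewrite -scalerBr -[y - y]/(y - y) !subrr scaler0 addr0 nrm0.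
Qed.

(* The resolvents [F t = (1 + t A)^-1], with [F 0 = 1] even though [A] is not everywhere defined. *)
Lemma euler_exists : exists F : R -> {linear H -> H}, (forall x, F 0 x = x) /\
  forall t x, 0 < t -> op_dom A (F t x) /\ F t x + t%:C *: A (F t x) = x.
Proof.
suff /choice[F FP] : forall t : R, exists L : {linear H -> H},
    (t = 0 -> forall x, L x = x) /\
    (0 < t -> forall x, op_dom A (L x) /\ L x + t%:C *: A (L x) = x).
  by exists F; split=> [|t x t0]; [exact: (FP 0).1|exact: (FP t).2].
move=> t; have [t0|t0] := ltP 0 t; last first.
  by exists idfun; split => // t0'; have := lt_le_trans t0' t0; rewrite ltxx.
have /choice[f fP] : forall y, exists x, op_dom A x /\ x + t%:C *: A x = y.
  by move=> y; have [x ? ?] := A_onto y t0; exists x.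
have f_lin : linear f.
  move=> a x y; apply: (euler_unique (ltW t0)).
  - exact: (fP _).1.
  - by apply: op_domP; exact: (fP _).1.
  rewrite (fP _).2 op_linear ?(fP _).1//; try exact: (fP _).1.
  by rewrite scalerDr addrACA (fP _).2 scalerA mulrC -scalerA -scalerDr (fP _).2.
pose L : {linear H -> H} := HB.pack f (GRing.isLinear.Build _ _ _ _ f f_lin).
by exists L; split=> [t0'|_ x]; [rewrite t0' ltxx in t0|exact: fP].
Qed.

Variable F : R -> {linear H -> H}.
Hypothesis F0 : forall x, F 0 x = x.
Hypothesis FP : forall t x, 0 < t -> op_dom A (F t x) /\ F t x + t%:C *: A (F t x) = x.

Lemma euler_dom t x : 0 < t -> op_dom A (F t x).
Proof. by move=> t0; exact: (FP x t0).1. Qed.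

Lemma euler_eq t x : 0 < t -> t%:C *: A (F t x) = x - F t x.
Proof. by move=> t0; rewrite -{2}(FP x t0).2 addrC addKr. Qed.

Lemma euler_left t x : 0 <= t -> op_dom A x -> F t (x + t%:C *: A x) = x.
Proof.
rewrite le_eqVlt => /predU1P[<-|t0] Ax; first by rewrite F0 scale0r addr0.
by apply: (euler_unique (ltW t0)); rewrite ?(FP _ t0).2//; exact: euler_dom.
Qed.

Lemma euler_contractive t : 0 <= t -> contractive (F t).
Proof.
rewrite le_eqVlt => /predU1P[<- x|t0 x]; first by rewrite F0.
by rewrite -{2}(FP x t0).2; apply: A_exp (ltW t0) (euler_dom _ t0).
Qed.

(** For [t > 0], [t A (F t x) = x - F t x] puts [A (F t x)] in the domain; then [A (F t x)] and
    [F t (A x)] have the same image under [1 + t A]. *)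
Lemma euler_commute t x : 0 <= t -> op_dom A x ->
  op_dom A (F t x) /\ A (F t x) = F t (A x).
Proof.
rewrite le_eqVlt => /predU1P[<- Ax|t0 Ax]; first by rewrite !F0.
have AF := euler_dom x t0.
have tN0 : t%:C != 0 by rewrite (inj_eq (@complexI R)) gt_eqF.
have AAF : op_dom A (A (F t x)).
  rewrite -[A _](scalerK tN0) euler_eq//.
  exact: op_dom_scale (op_dom_sub Ax AF).
split=> //; apply: (euler_unique (ltW t0)) => //; first exact: euler_dom.
rewrite (FP _ t0).2 -op_scale// -op_add//; last exact: op_dom_scale.
by rewrite (FP _ t0).2.
Qed.

Definition op_dom2 x := op_dom A x /\ op_dom A (A x).

Lemma euler_dom2 t x : 0 <= t -> op_dom2 x ->
  op_dom2 (F t x) /\ A (A (F t x)) = F t (A (A x)).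
Proof.
move=> t0 [Ax AAx]; have [AF E] := euler_commute t0 Ax.
have [AAF E2] := euler_commute t0 AAx.
by rewrite E E2; split => //; split => //; rewrite E.
Qed.

Lemma euler_sub t x : 0 <= t -> op_dom A x -> x - F t x = t%:C *: F t (A x).
Proof.
move=> t0 Ax; rewrite -{1}(euler_left t0 Ax) -linearB addrC addKr.
exact: linearZ.
Qed.

Lemma euler_sub_le t x : 0 <= t -> op_dom A x ->
  nrm (F t x - x) <= t * nrm (A x).
Proof.
move=> t0 Ax; rewrite nrmC euler_sub// nrmZr ger0_norm//.
by rewrite ler_wpM2l//; exact: euler_contractive.
Qed.

Lemma euler_sub2_le t x : 0 <= t -> op_dom2 x ->
  nrm (F t x - x + t%:C *: A x) <= t ^+ 2 * nrm (A (A x)).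
Proof.
move=> t0 [Ax AAx]; rewrite -opprB euler_sub// addrC -scalerBr nrmZr ger0_norm//.
by rewrite expr2 -mulrA ler_wpM2l// nrmC euler_sub_le.
Qed.

(** With [z = F (s + t) x] one has [x = (1 + t A) (1 + s A) z - s t A^2 z], so the difference is
    exactly [- s t F s (F t (A^2 z))], where [A^2 z = F (s + t) (A^2 x)]. *)
Lemma euler_comp_le s t x : 0 <= s -> 0 <= t -> op_dom2 x ->
  nrm (F s (F t x) - F (s + t) x) <= s * t * nrm (A (A x)).
Proof.
move=> s0 t0 Ax2; have st0 : 0 <= s + t by rewrite addr_ge0.
have [[Az AAz] AAzE] := euler_dom2 st0 Ax2.
set z := F (s + t) x in Az AAz AAzE *.
have xE : x = z + s%:C *: A z + t%:C *: A (z + s%:C *: A z) - (s * t)%:C *: A (A z).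
  rewrite op_add ?op_scale//; last exact: op_dom_scale.
  have /eqP := euler_sub st0 Ax2.1; rewrite -/z subr_eq => /eqP {1}->.
  rewrite -(euler_commute st0 Ax2.1).2 -/z rmorphD scalerDl.
  by rewrite [LHS]addrC scalerDr scalerA rmorphM [t%:C * _]mulrC !addrA addrK.
have -> : F s (F t x) - z = - ((s * t)%:C *: F s (F t (A (A z)))).
  rewrite {1}xE linearB linearZ (euler_left t0); last first.
    by apply: op_dom_add => //; exact: op_dom_scale.
  by rewrite linearB linearZ (euler_left s0)// addrAC subrr add0r.
rewrite nrmN nrmZr ger0_norm ?mulr_ge0// ler_wpM2l ?mulr_ge0//.
rewrite AAzE.
by do 2!(apply: le_trans (euler_contractive _ _) _ => //); exact: euler_contractive.
Qed.

Lemma euler_comm s t x : 0 <= s -> 0 <= t -> F s (F t x) = F t (F s x).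
Proof.
rewrite [0 <= t]le_eqVlt => s0 /predU1P[<-|t0]; first by rewrite !F0.
have [Aw xE] := FP x t0; set w := F t x in Aw xE *.
rewrite -xE linearD linearZ -(euler_commute s0 Aw).2.
by rewrite euler_left ?ltW//; exact: (euler_commute s0 Aw).1.
Qed.

Lemma euler_small x (e : R) : 0 < e ->
  exists2 d, 0 < d & forall t, 0 <= t <= d -> nrm (F t x - x) <= e.
Proof. exact: contractive_small A_dense euler_contractive euler_sub_le. Qed.

(** The domain of [A^2] is a core of [A]: take [y = F t x] with [t] small, for which
    [A y = F t (A x)]. *)
Lemma dom2_core x (e : R) : op_dom A x -> 0 < e ->
  exists y, [/\ op_dom2 y, nrm (y - x) <= e & nrm (A y - A x) <= e].
Proof.
move=> Ax e0; have [d d0 dP] := euler_small x e0; have [c c0 cP] := euler_small (A x) e0.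
pose t := Num.min d c.
have t0 : 0 < t by rewrite lt_min d0.
have [td tc] : 0 <= t <= d /\ 0 <= t <= c by rewrite ltW//= !ge_min !lexx orbT.
have [AF AFE] := euler_commute (ltW t0) Ax.
exists (F t x); split; [split => //|exact: dP|rewrite AFE; exact: cP].
by rewrite AFE; exact: euler_dom.
Qed.

Lemma dense_dom2 x (e : R) : 0 < e -> exists2 y, op_dom2 y & nrm (y - x) <= e.
Proof.
move=> e0; have [|y Ay yx] := @dense_nrm _ _ _ x (e / 2) A_dense.
  by rewrite divr_gt0.
have [|z [Az zy _]] := @dom2_core y (e / 2) Ay; first by rewrite divr_gt0.
by exists z => //; have := nrm_triangle y z x; lra.
Qed.

(** * Convergence of the dyadic Euler approximants *)

Definition euler_iter n (t : R) (x : H) : H := iter (2 ^ n) (F (t * 2^-1 ^+ n)) x.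

Lemma iter_euler_dom2 t x j : 0 <= t -> op_dom2 x ->
  op_dom2 (iter j (F t) x) /\ A (A (iter j (F t) x)) = iter j (F t) (A (A x)).
Proof.
move=> t0 Ax; elim: j => //= j [IH1 IH2].
by have [? ->] := euler_dom2 t0 IH1; rewrite IH2.
Qed.

Lemma iter_euler_comp_le s t x N : 0 <= s -> 0 <= t -> op_dom2 x ->
  nrm (iter N (F s) (iter N (F t) x) - iter N (F (s + t)) x)
    <= N%:R * (s * t * nrm (A (A x))).
Proof.
move=> s0 t0 Ax; have st0 : 0 <= s + t by rewrite addr_ge0.
have comm k y : F t (iter k (F s) y) = iter k (F s) (F t y).
  by elim: k => //= k IH; rewrite euler_comm// IH.
(* Since [F s] and [F t] commute, the two runs of [N] steps interleave into [N] steps of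
   [F s \o F t], each then compared with [F (s + t)]. *)
have -> : iter N (F s) (iter N (F t) x) = iter N (F s \o F t : {linear H -> H}) x.
  by elim: N => //= N <-; rewrite comm.
apply: iter_sub_le => [y|j] /=.
  by apply: le_trans (euler_contractive s0 _) _; exact: euler_contractive.
have [Aj AjE] := iter_euler_dom2 j st0 Ax.
apply: le_trans (euler_comp_le s0 t0 Aj) _; rewrite AjE ler_wpM2l ?mulr_ge0//.
exact/iter_contractive/euler_contractive.
Qed.

Lemma half_pow_ge0 (t : R) n : 0 <= t -> 0 <= t * 2^-1 ^+ n.
Proof. by move=> t0; rewrite mulr_ge0// ltW// half_pow_gt0. Qed.

Lemma natr_half_pow n : (2 ^ n)%:R * 2^-1 ^+ n = 1 :> R.
Proof. by rewrite natrX -exprMn divff ?expr1n// pnatr_eq0. Qed.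

Lemma euler_iter_contractive n t : 0 <= t -> contractive (euler_iter n t).
Proof. by move=> t0; exact/iter_contractive/euler_contractive/half_pow_ge0. Qed.

(** Each of the [2^n] steps costs [(s 2^-n) (t 2^-n) |A^2 x|], leaving one factor [2^-n]. Equal
    times give convergence, general times the semigroup law. *)
Lemma euler_iter_comp_le n s t x : 0 <= s -> 0 <= t -> op_dom2 x ->
  nrm (euler_iter n s (euler_iter n t x) - euler_iter n (s + t) x)
    <= s * t * nrm (A (A x)) * 2^-1 ^+ n.
Proof.
move=> s0 t0 Ax.
have := iter_euler_comp_le (2 ^ n) (half_pow_ge0 n s0) (half_pow_ge0 n t0) Ax.
rewrite -mulrDl => /le_trans; apply.
rewrite [leLHS](_ : _ = (2 ^ n)%:R * 2^-1 ^+ n * (s * t * nrm (A (A x)) * 2^-1 ^+ n)).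
  by rewrite natr_half_pow mul1r.
by ring.
Qed.

(** Both times are [t / 2]: two runs at level [n] for time [t / 2] are one run at level [n.+1] for
    time [t]. *)
Lemma euler_iter_step n t x : 0 <= t -> op_dom2 x ->
  nrm (euler_iter n.+1 t x - euler_iter n t x)
    <= t ^+ 2 * nrm (A (A x)) / 4 * 2^-1 ^+ n.
Proof.
move=> t0 Ax; have t20 : 0 <= t / 2 by rewrite divr_ge0.
have := euler_iter_comp_le n t20 t20 Ax; rewrite -splitr.
have -> : euler_iter n (t / 2) (euler_iter n (t / 2) x) = euler_iter n.+1 t x.
  by rewrite /euler_iter -iterD addnn -mul2n -expnS exprS mulrA.
by move=> /le_trans; apply; rewrite le_eqVlt; apply/orP; left; apply/eqP; field.
Qed.

Lemma euler_iter0 t x : euler_iter 0 t x = F t x.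
Proof. by rewrite /euler_iter /= expr0 mulr1. Qed.

Lemma euler_iter_linear n t : linear (euler_iter n t).
Proof.
move=> a x y; rewrite /euler_iter; elim: (2 ^ n)%N => //= N ->.
by rewrite linearP.
Qed.

Lemma euler_iter_sub n t x y :
  euler_iter n t x - euler_iter n t y = euler_iter n t (x - y).
Proof.
have := euler_iter_linear n t (-1) y x.
by rewrite !scaleN1r [- y + x]addrC [- _ + euler_iter n t x]addrC => ->.
Qed.

Lemma euler_iter_cvg t x : 0 <= t -> exists l : H, euler_iter n t x @[n --> \oo] --> l.
Proof.
move=> t0; apply: nrm_cauchy_cvg => e e0.
(* Four errors of at most [e / 5]: replacing [x] by [y] at levels [n] and [N], and the distances of
   these two approximants of [y] to their limit. *)
have [|y Ay yx] := @dense_dom2 x (e / 5); first by rewrite divr_gt0.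
have [l _ lP] := geometric_cvg (fun n => euler_iter_step n t0 Ay).
have e5 : 0 < e / 5 by rewrite divr_gt0.
have [N _ NP] := half_pow_small (2 * (t ^+ 2 * nrm (A (A y)) / 4)) e5.
exists N => n Nn; have := le_lt_trans (lP n) (NP n Nn).
have := le_lt_trans (lP N) (NP N (leqnn N)); rewrite nrmC.
have diff k : nrm (euler_iter k t x - euler_iter k t y) <= e / 5.
  by rewrite euler_iter_sub; apply: le_trans (euler_iter_contractive _ t0 _) _; rewrite nrmC.
have := diff n; have := diff N; rewrite (nrmC (euler_iter N t x)).
have := nrm_triangle (euler_iter n t y) (euler_iter n t x) (euler_iter N t x).
have := nrm_triangle l (euler_iter n t y) (euler_iter N t x).
have := nrm_triangle (euler_iter N t y) l (euler_iter N t x).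
lra.
Qed.

Lemma euler_limit_exists : exists U : R -> {linear H -> H},
  forall t x, 0 <= t -> euler_iter n t x @[n --> \oo] --> U t x.
Proof.
suff /choice[U UP] : forall t, exists L : {linear H -> H},
  0 <= t -> forall x, euler_iter n t x @[n --> \oo] --> L x.
  by exists U => t x t0; exact: UP.
move=> t; have [t0|t0] := leP 0 t; last by exists idfun.
have /choice[f fP] := fun x => euler_iter_cvg x t0.
have f_lin : linear f.
  move=> a x y; apply: nrm_cvg_unique (fP _) _ => //.
  under eq_fun do rewrite euler_iter_linear.
  by apply: cvgD; [apply: cvgZr; exact: fP|exact: fP].
pose L : {linear H -> H} := HB.pack f (GRing.isLinear.Build _ _ _ _ f f_lin).
by exists L.
Qed.

(** * The limit semigroup *)

Variable U : R -> {linear H -> H}.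
Hypothesis UP : forall t x, 0 <= t -> euler_iter n t x @[n --> \oo] --> U t x.

Lemma limit_contractive t : 0 <= t -> contractive (U t).
Proof.
move=> t0 x; rewrite -[U t x]subr0; apply: (nrm_cvg_le (@UP _ x t0)) => n.
by rewrite subr0; exact: euler_iter_contractive.
Qed.

(** The approximant of level 0 is [F t] itself, and the geometric corrections add up to at most
    twice the first bound. *)
Lemma limit_euler_le t x : 0 <= t -> op_dom2 x ->
  nrm (U t x - F t x) <= t ^+ 2 * nrm (A (A x)) / 2.
Proof.
move=> t0 Ax; apply: (nrm_cvg_le (@UP _ x t0)) => n; rewrite -euler_iter0.
have := geometric_tail n 0 (fun n => euler_iter_step n t0 Ax).
rewrite add0n => /le_trans; apply; rewrite expr0.
have := ltW (@half_pow_gt0 R n).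
have : 0 <= t ^+ 2 * nrm (A (A x)) by rewrite mulr_ge0 ?nrm_ge0// exprn_ge0.
nra.
Qed.

Lemma limit_sub_le t x : 0 <= t -> op_dom A x ->
  nrm (U t x - x) <= t * nrm (A x).
Proof.
move=> t0 Ax; apply: (nrm_cvg_le (@UP _ x t0)) => n.
have c0 := half_pow_ge0 n t0.
(* Comparing with the iterates of the identity: [2^n] steps, each moving [x] by at most
   [t 2^-n |A x|]. *)
have := @iter_sub_le _ _ (F (t * 2^-1 ^+ n)) id x (t * 2^-1 ^+ n * nrm (A x)) (2 ^ n).
have -> N : iter N id x = x by elim: N.
move=> le1; apply: le_trans (le1 _ _) _ => [|j|].
- exact: euler_contractive.
- by have -> : iter j id x = x by [elim: j]; exact: euler_sub_le.
- rewrite [leLHS](_ : _ = (2 ^ n)%:R * 2^-1 ^+ n * (t * nrm (A x))); last by ring.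
  by rewrite natr_half_pow mul1r.
Qed.

Lemma limit0 x : U 0 x = x.
Proof.
apply: nrm_small_eq => e e0.
have [|y Ay yx] := @dense_nrm _ _ _ x (e / 2) A_dense; first by rewrite divr_gt0.
have := limit_sub_le (lexx 0) Ay; rewrite mul0r.
have : nrm (U 0 x - U 0 y) <= nrm (y - x).
  by rewrite -linearB (nrmC y); exact: limit_contractive.
have := nrm_triangle (U 0 y) (U 0 x) x; have := nrm_triangle y (U 0 y) x; lra.
Qed.

(** On the domain of [A^2] the defect of the approximants is [O (2^-n)] and vanishes in the limit;
    density and contractivity extend the law to [H]. *)
Lemma limit_add s t x : 0 <= s -> 0 <= t -> U (s + t) x = U s (U t x).
Proof.
move=> s0 t0; have st0 : 0 <= s + t by rewrite addr_ge0.
have cst : contractive (fun y => U s (U t y)).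
  by move=> y; apply: le_trans (limit_contractive s0 _) (limit_contractive t0 _).
have dom2_add y : op_dom2 y -> U (s + t) y = U s (U t y).
  move=> Ay; apply: nrm_cvg_unique (UP st0) _ => //.
  apply/nrm_cvgP => e e0; have e4 : 0 < e / 4 by rewrite divr_gt0.
  have /nrm_cvgP/(_ _ e4) [N1 _ N1P] := @UP _ y t0.
  have /nrm_cvgP/(_ _ e4) [N2 _ N2P] := @UP _ (U t y) s0.
  have [N3 _ N3P] := half_pow_small (s * t * nrm (A (A y))) e4.
  exists (maxn N1 (maxn N2 N3)) => // n /=; rewrite !geq_max => /and3P[n1 n2 n3].
  have := N1P n n1; have := N2P n n2; have := N3P n n3 => /=.
  have := euler_iter_comp_le n s0 t0 Ay.
  have := euler_iter_contractive n s0 (euler_iter n t y - U t y).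
  rewrite -euler_iter_sub.
  set a := euler_iter n s (euler_iter n t y); set b := euler_iter n s (U t y).
  set c := euler_iter n (s + t) y.
  have := nrm_triangle a c (U s (U t y)); have := nrm_triangle b a (U s (U t y)).
  rewrite (nrmC c a) => h1 h2 h3 h4 h5 h6 h7; lra.
apply: nrm_small_eq => e e0.
have [|y Ay yx] := @dense_dom2 x (e / 2); first by rewrite divr_gt0.
have h1 : nrm (U (s + t) x - U (s + t) y) <= nrm (y - x).
  by rewrite -linearB (nrmC y); exact: limit_contractive.
have h2 : nrm (U (s + t) y - U s (U t x)) <= nrm (y - x).
  by rewrite dom2_add// -!linearB; exact: cst.
have := nrm_triangle (U (s + t) y) (U (s + t) x) (U s (U t x)); lra.
Qed.

Lemma limit_small x (e : R) : 0 < e ->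
  exists2 d, 0 < d & forall t, 0 <= t <= d -> nrm (U t x - x) <= e.
Proof. exact: contractive_small A_dense limit_contractive limit_sub_le. Qed.

(** Reduces continuity at any time, from either side, to continuity at 0. *)
Lemma limit_dist_le s t x : 0 <= s <= t -> nrm (U t x - U s x) <= nrm (U (t - s) x - x).
Proof.
move=> /andP[s0 st]; have ts0 : 0 <= t - s by rewrite subr_ge0.
have -> : U t x = U s (U (t - s) x) by rewrite -limit_add// subrKC.
by rewrite -linearB; exact: limit_contractive.
Qed.

Lemma limit_C0_semigroup : C0_semigroup U.
Proof.
split=> [t t0|||x].
- exists 1 => x; rewrite !nrmE -rmorphM lecR mul1r; exact: limit_contractive.
- exact: limit0.
- by move=> s t x; exact: limit_add.
apply/subspace_continuousP => t; rewrite /= in_itv/= andbT => t0.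
apply/nrm_cvgP => e e0; have e2 : 0 < e / 2 by rewrite divr_gt0.
have [d d0 dP] := limit_small x e2.
apply: filterS (nbhsx_ballx t d d0) => s; rewrite /ball/= ltr_norml.
rewrite in_itv/= andbT => /andP[sd1 sd2] s0.
suff : nrm (U s x - U t x) <= e / 2 by move=> ?; lra.
have [st|ts] := leP s t.
  by rewrite nrmC; apply: le_trans (limit_dist_le _ _) (dP _ _); rewrite ?s0// subr_ge0 st; lra.
by apply: le_trans (limit_dist_le _ _) (dP _ _); rewrite ?t0 ?(ltW ts)// subr_ge0 (ltW ts); lra.
Qed.

End ImplicitEuler.

(** * Right derivatives and uniqueness of the generated semigroup *)

Section Generator.
Set Implicit Arguments.
Unset Strict Implicit.
Local Open Scope classical_set_scope.
Local Open Scope ring_scope.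
Context {R : realType} {H : completeNormedModType R[i]}.

Lemma right_derivativeP (u : R -> H) (x y : H) :
  ((h^-1)%:C *: (u h - x) @[h --> (0 : R)^'+] --> y) <->
  forall e : R, 0 < e -> exists2 d, 0 < d &
    forall h, 0 < h <= d -> nrm (u h - x - h%:C *: y) <= e * h.
Proof.
have quotient h : 0 < h ->
    nrm (u h - x - h%:C *: y) = h * nrm ((h^-1)%:C *: (u h - x) - y).
  move=> h0; have := nrmZr h ((h^-1)%:C *: (u h - x) - y).
  rewrite gtr0_norm// => <-; rewrite scalerBr scalerA -rmorphM.
  by rewrite divff ?gt_eqF// scale1r.
split=> [/nrm_cvgP uy e e0|uy].
  have [d /= d0 dP] := uy e e0; exists (d / 2); first by rewrite divr_gt0.
  move=> h /andP[h0 hd]; rewrite quotient// [e * h]mulrC ler_pM2l//.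
  apply/ltW/dP => //; rewrite /= sub0r normrN gtr0_norm//; lra.
apply/nrm_cvgP => e e0; have e2 : 0 < e / 2 by rewrite divr_gt0.
have [d d0 dP] := uy _ e2; exists d => //= h; rewrite /= sub0r normrN => hd h0.
have hd' : h <= d by apply: ltW; apply: le_lt_trans hd; exact: ler_norm.
have := dP h; rewrite h0 hd' => /(_ isT).
rewrite quotient// [e / 2 * h]mulrC ler_pM2l// => ?; lra.
Qed.

(** Let [m] be the supremum of the times in [[0, t]] satisfying the bound. The left condition [fl]
    gives the bound at [m], and if [m < t] the growth condition [fr] would carry it beyond [m]. *)
Lemma right_dini_le (f : R -> R) (t e : R) : 0 <= t -> 0 <= e ->
  (forall s, 0 <= s < t -> exists2 d, 0 < d &
    forall h, 0 < h <= d -> f (s + h) <= f s + e * h) ->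
  (forall s k, 0 <= s -> 0 < k -> exists2 d, 0 < d &
    forall r, 0 <= r <= s -> s - d < r -> f s <= f r + k) ->
  f t <= f 0 + e * t.
Proof.
move=> t0 e0 fr fl; pose S := [set s | 0 <= s <= t /\ f s <= f 0 + e * s].
have S0 : S 0 by rewrite /S/= lexx mulr0 addr0.
have supS : has_sup S by split; [exists 0|exists t => s [/andP[]]].
pose m := sup S.
have mS s : S s -> s <= m by move=> Ss; apply: sup_upper_bound.
have m0 : 0 <= m by exact: mS.
have mt : m <= t by apply: ge_sup; [exists 0|move=> s [/andP[]]].
have fm : f m <= f 0 + e * m.
  apply/ler_addgt0Pr => k k0; have [d d0 dP] := fl m k m0 k0.
  have [r Sr rm] := sup_adherent d0 supS.
  have [/andP[r0 _] fr0] := Sr.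
  apply: le_trans (dP r _ rm) _; first by rewrite r0 mS.
  by rewrite lerD2r; apply: le_trans fr0 _; rewrite lerD2l ler_wpM2l// mS.
have [mt'|tm] := ltP m t; last first.
  by rewrite (_ : t = m)//; apply/eqP; rewrite eq_le tm.
have [|d d0 dP] := fr m; first by rewrite m0.
pose h := Num.min d (t - m).
have h0 : 0 < h by rewrite lt_min d0 subr_gt0.
have [hd htm] : h <= d /\ h <= t - m by rewrite !ge_min !lexx orbT.
suff : m + h <= m by lra.
apply: mS; split; first by apply/andP; split; lra.
have := dP h; rewrite h0 hd => /(_ isT); lra.
Qed.

Variable G : operator H.
Hypothesis G_dense : densely_defined G.

Lemma generatesP (U : R -> {linear H -> H}) x y : generates G U ->
  (op_dom G x /\ y = G x) <-> forall e : R, 0 < e -> exists2 d, 0 < d &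
    forall h, 0 < h <= d -> nrm (U h x - x - h%:C *: y) <= e * h.
Proof. by move=> GU; rewrite -(right_derivativeP (U ^~ x)) -GU. Qed.

Lemma C0_semigroup_dist (U : R -> {linear H -> H}) x (s e : R) :
  C0_semigroup U -> 0 <= s -> 0 < e -> exists2 d, 0 < d &
    forall r, 0 <= r -> `|r - s| < d -> nrm (U r x - U s x) < e.
Proof.
move=> [_ _ _ Uc] s0 e0; have /subspace_continuousP/(_ s) := Uc x.
rewrite /= in_itv/= s0 => /(_ isT)/nrm_cvgP/(_ _ e0)[d /= d0 dP].
exists d => // r r0 rs; apply: dP => /=; first by rewrite distrC.
by rewrite in_itv/= r0.
Qed.

(** For [x] in the domain, [V s x] stays there, so [V h] and [U h] agree to first order at [V s x];
    as [U h] is contractive, [|V s x - U s x|] grows at arbitrarily small rate from 0. Density gives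
    all [x]. *)
Lemma generates_unique (U V : R -> {linear H -> H}) :
  C0_semigroup U -> (forall t, 0 <= t -> contractive (U t)) -> generates G U ->
  C0_semigroup V -> generates G V ->
  forall t x, 0 <= t -> V t x = U t x.
Proof.
move=> cU Uc GU cV GV.
have [Ub U0 UD _] := cU; have [Vb V0 VD _] := cV.
have dom_eq t x : 0 <= t -> op_dom G x -> V t x = U t x.
  move=> t0 Gx; apply: nrm_small_eq => e e0.
  pose f s := nrm (V s x - U s x).
  have f0 : f 0 = 0 by rewrite /f V0 U0 subrr nrm0.
  have t1 : 0 < t + 1 by lra.
  (* The slope [e / (t + 1)] keeps the total growth below [e] and makes sense at [t = 0]. *)
  suff : f t <= f 0 + e / (t + 1) * t.
    rewrite f0 add0r => /le_trans; apply.
    rewrite -mulrA ler_piMr ?(ltW e0)// mulrC ler_pdivrMr//; lra.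
  apply: right_dini_le => //; first by rewrite divr_ge0 ?ltW.
    move=> s /andP[s0 _]; set k := e / _; have k0 : 0 < k by rewrite divr_gt0.
    have k2 : 0 < k / 2 by rewrite divr_gt0.
    (* The bounded [V s] commutes with [V h], so it maps the right derivative at [x] to the one at
       [V s x]. *)
    have [GVs _] : op_dom G (V s x) /\ V s (G x) = G (V s x).
      apply/(generatesP _ _ GV) => c c0.
      have [M MP] := Vb s s0.
      have M1 : 0 < `|M| + 1 by rewrite ltr_wpDl.
      have [|d d0 dP] := ((generatesP x (G x) GV).1 (conj Gx erefl)) (c / (`|M| + 1)).
        by rewrite divr_gt0.
      exists d => // h hd; have h0 : 0 <= h by case/andP: hd => /ltW.
      have -> : V h (V s x) = V s (V h x) by rewrite -!VD// addrC.
      rewrite -linearB -linearZ -linearB.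
      have := MP (V h x - x - h%:C *: G x).
      rewrite !nrmE -rmorphM lecR => /le_trans; apply.
      have := dP h hd; set n := nrm _; rewrite mulrAC ler_pdivlMr// => le1.
      have := ler_norm M; have : 0 <= n := nrm_ge0 _; nra.
    have [d d0 dP] := ((generatesP (V s x) _ GV).1 (conj GVs erefl)) _ k2.
    have [c c0 cP] := ((generatesP (V s x) _ GU).1 (conj GVs erefl)) _ k2.
    exists (Num.min d c) => [|h]; first by rewrite lt_min d0.
    rewrite le_min => /and3P[h0 hd hc]; rewrite /f.
    have := dP h; have := cP h; rewrite h0 hd hc => /(_ isT) h1 /(_ isT) h2.
    have -> : V (s + h) x = V h (V s x) by rewrite addrC VD// ltW.
    have -> : U (s + h) x = U h (U s x) by rewrite addrC UD// ltW.
    have := Uc h (ltW h0) (V s x - U s x); rewrite linearB.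
    have := nrm_triangle (U h (V s x)) (V h (V s x)) (U h (U s x)).
    have : nrm (V h (V s x) - U h (V s x)) <= k / 2 * h + k / 2 * h.
      apply: le_trans (lerD h2 h1).
      rewrite -!addrA -!opprD [X in _ <= _ + X]nrmC.
      exact: nrm_triangle.
    lra.
  move=> s k s0 k0; have k2 : 0 < k / 2 by rewrite divr_gt0.
  have [d d0 dP] := C0_semigroup_dist x cV s0 k2.
  have [c c0 cP] := C0_semigroup_dist x cU s0 k2.
  exists (Num.min d c) => [|r]; first by rewrite lt_min d0.
  move=> /andP[r0 rs]; rewrite ltrBlDr => sr; rewrite /f.
  have [hd hc] : `|r - s| < d /\ `|r - s| < c.
    have : s - r < Num.min d c by lra.
    by rewrite distrC ger0_norm ?subr_ge0// lt_min => /andP.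
  have := dP r r0 hd; have := cP r r0 hc; rewrite (nrmC (V r x)).
  have := nrm_triangle (V r x) (V s x) (U s x); have := nrm_triangle (U r x) (V r x) (U s x); lra.
move=> t x t0; apply: nrm_small_eq => e e0.
have [M MP] := Vb t t0.
have M1 : 0 < `|M| + 1 by rewrite ltr_wpDl.
have [|y Gy yx] := @dense_nrm _ _ _ x (e / (`|M| + 1)) G_dense; first by rewrite divr_gt0.
have h1 : nrm (V t x - V t y) <= `|M| * nrm (y - x).
  rewrite -linearB (nrmC y); have := MP (x - y).
  rewrite !nrmE -rmorphM lecR => /le_trans; apply.
  by rewrite ler_wpM2r ?nrm_ge0// ler_norm.
have h2 : nrm (V t y - U t x) <= nrm (y - x) by rewrite dom_eq// -linearB; exact: Uc.
have := nrm_triangle (V t y) (V t x) (U t x); move: yx; rewrite ltr_pdivlMr// => yx.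
lra.
Qed.

End Generator.

(** * Identification of the generator of the limit semigroup *)

Section LumerPhillips.
Set Implicit Arguments.
Unset Strict Implicit.
Local Open Scope classical_set_scope.
Local Open Scope ring_scope.
Context {R : realType} {H : completeNormedModType R[i]}.
Variable A : operator H.
Hypothesis A_exp : forall (t : R) x, 0 <= t -> op_dom A x ->
  nrm x <= nrm (x + t%:C *: A x).
Hypothesis A_onto : forall (t : R) y, 0 < t ->
  exists2 x, op_dom A x & x + t%:C *: A x = y.
Hypothesis A_dense : dense (op_dom A).
Variable F : R -> {linear H -> H}.
Hypothesis F0 : forall x, F 0 x = x.
Hypothesis FP : forall t x, 0 < t -> op_dom A (F t x) /\ F t x + t%:C *: A (F t x) = x.
Variable U : R -> {linear H -> H}.
Hypothesis UP : forall t x, 0 <= t -> euler_iter F n t x @[n --> \oo] --> U t x.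

(** For [y] in the domain of [A^2] the error is [O (h^2)]; the remainder at [x - y] is at most
    [2 h |A (x - y)|], small because that domain is a core. *)
Lemma limit_right_derivative x (e : R) : op_dom A x -> 0 < e ->
  exists2 d, 0 < d & forall h, 0 < h <= d -> nrm (U h x - x - h%:C *: - A x) <= e * h.
Proof.
move=> Ax e0; have e4 : 0 < e / 4 by rewrite divr_gt0.
have [y [Ay _ yx]] := dom2_core A_exp A_dense F0 FP Ax e4.
pose K := nrm (A (A y)) * 2; have K0 : 0 <= K by rewrite mulr_ge0// nrm_ge0.
exists (e / 2 / (K + 1)); first by rewrite !divr_gt0// ltr_wpDl.
move=> h /andP[h0]; rewrite ler_pdivlMr ?ltr_wpDl// => hK.
have h0' := ltW h0.
rewrite scalerN opprK.
have le_y : nrm (U h y - y + h%:C *: A y) <= h ^+ 2 * K.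
  have := limit_euler_le A_exp F0 FP UP h0' Ay.
  have := euler_sub2_le A_exp F0 FP h0' Ay.
  have := nrmD (U h y - F h y) (F h y - y + h%:C *: A y).
  rewrite addrA subrKA -/K => h1 h2 h3.
  apply: le_trans h1 _; apply: le_trans (lerD h3 h2) _; rewrite /K.
  have : 0 <= h ^+ 2 * nrm (A (A y)) by rewrite mulr_ge0 ?nrm_ge0// exprn_ge0.
  lra.
have Axy : op_dom A (x - y) by apply: op_dom_sub => //; exact: Ay.1.
have le_xy : nrm (U h x - x + h%:C *: A x - (U h y - y + h%:C *: A y)) <= e / 2 * h.
  have -> : U h x - x + h%:C *: A x - (U h y - y + h%:C *: A y)
      = U h (x - y) - (x - y) + h%:C *: A (x - y).
    rewrite linearB op_sub//; last exact: Ay.1.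
    by rewrite scalerBr opprD addrACA; congr (_ + _); rewrite !opprD addrACA.
  apply: le_trans (nrmD _ _) _; rewrite nrmZr gtr0_norm//.
  have := limit_sub_le A_exp F0 FP UP h0' Axy.
  rewrite op_sub//; last exact: Ay.1.
  rewrite (nrmC (A x)); move: (nrm _) (nrm _) yx => p q; nra.
have := nrmD (U h x - x + h%:C *: A x - (U h y - y + h%:C *: A y)) (U h y - y + h%:C *: A y).
rewrite subrK => /le_trans; apply; apply: le_trans (lerD le_xy le_y) _.
have : h ^+ 2 * K <= e / 2 * h.
  by rewrite expr2 mulrAC -mulrA [e / 2 * h]mulrC ler_pM2l//; nra.
lra.
Qed.

Lemma limit_generates : generates (opp_op A) U.
Proof.
have Uc := limit_contractive A_exp F0 FP UP.
move=> x y; rewrite /op_graph/=; split=> [[Ax ->]|/right_derivativeP xy].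
  by apply/right_derivativeP => e; exact: limit_right_derivative.
(* If [U] has right derivative [y] at [x], solve [z + A z = x - y]. Then [x - z] is its own right
   derivative, so contractivity gives [(1 + h) |x - z| <= |x - z| + e h], which forces [x = z]. *)
have [z Az zE] := A_onto (x - y) ltr01.
rewrite scale1r in zE.
have yE : y = x - z - A z by rewrite -addrA -opprD zE subKr.
suff : x - z = 0.
  by move/eqP; rewrite subr_eq0 => /eqP xz; rewrite yE xz subrr add0r.
apply/nrm0_eq0/eqP; rewrite eq_le nrm_ge0 andbT; apply/ler_addgt0Pr => e e0.
rewrite add0r; have e2 : 0 < e / 2 by rewrite divr_gt0.
have [d d0 dP] := xy _ e2; have [c c0 cP] := limit_right_derivative Az e2.
pose h := Num.min d c; have h0 : 0 < h by rewrite lt_min d0.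
have [hd hc] : h <= d /\ h <= c by rewrite !ge_min !lexx orbT.
have := dP h; have := cP h; rewrite h0 hd hc => /(_ isT) h1 /(_ isT) h2.
have wE : U h (x - z) - (x - z) - h%:C *: (x - z)
    = (U h x - x - h%:C *: y) - (U h z - z - h%:C *: - A z).
  have -> : h%:C *: (x - z) = h%:C *: y - h%:C *: - A z.
    by rewrite -scalerBr yE opprK subrK.
  rewrite linearB [- (_ - _ - h%:C *: - A z)]opprD addrACA.
  by congr (_ + _); rewrite !opprD// addrACA.
have := nrm_subr ((1 + h)%:C *: (x - z)) (U h (x - z)).
rewrite nrmZr gtr0_norm ?addr_gt0// (nrmC _ (U h _)) rmorphD scalerDl scale1r opprD addrA wE.
have := Uc h (ltW h0) (x - z).
have := nrmD (U h x - x - h%:C *: y) (- (U h z - z - h%:C *: - A z)).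
rewrite nrmN => h3 h4 h5.
by rewrite -(ler_pM2l h0); nra.
Qed.

End LumerPhillips.

(** * Numerical ranges *)

Section NumericalRange.
Set Implicit Arguments.
Unset Strict Implicit.
Context {R : realType} {H : completeNormedModType R[i]}.
Variable dot : {dot H for Num.conj}.
Hypothesis hdot : hilbert_norm dot.
Local Notation ip := (inner dot).

Definition unitary (e : R[i]) := complex.Re e ^+ 2 + complex.Im e ^+ 2 = 1.

(** Homogeneous form of a half-plane [Re (e w) <= k] containing the numerical range. *)
Definition support_le (C : H -> H) (e : R[i]) (k : R) :=
  forall x, complex.Re (e * ip x (C x)) <= k * nrm x ^+ 2.

Lemma support_le_trans C e k k' : k <= k' -> support_le C e k -> support_le C e k'.
Proof. by move=> kk' Ck x; apply: le_trans (Ck x) _; rewrite ler_wpM2r ?exprn_ge0 ?nrm_ge0. Qed.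

Lemma unitary_conj (e : R[i]) : unitary e -> e * e^*%C = 1.
Proof.
case: e => p q; rewrite /unitary/= => pq; apply/eqP; rewrite eq_complex /=.
by apply/andP; split; apply/eqP; rewrite -?pq; ring.
Qed.

(* With [a = r f / e], [y1 = (a + C) x] and [y2 = (a - C) x], one has
   [(a - C) y1 = (a + C) y2 = (a^2 - C^2) x] and [y1 + y2 = 2 a x]. *)
Lemma square_support_le (C : {linear H -> H}) (e f : R[i]) (r k : R) :
  unitary e -> 0 < r -> k <= r * complex.Re (f ^+ 2 * e^*%C) ->
  support_le C f k -> support_le C (- f) k -> unitary f ->
  support_le (C \o C) e (r ^+ 2 * complex.Re (f ^+ 2 * e^*%C)).
Proof.
move=> ue r0 kr Cf CNf uf x.
have e1 := unitary_conj ue.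
set g := f ^+ 2 * e^*%C in kr *.
pose a := r%:C * f * e^*%C.
have aa : a * a^*%C = (r ^+ 2)%:C.
  rewrite /a; move: ue uf; case: (e) => p q; case: (f) => u v.
  rewrite /unitary /= => pq uv; apply/eqP; rewrite eq_complex /=.
  apply/andP; split; apply/eqP; last by ring.
  by rewrite -[RHS]mulr1 -{1}pq -[RHS]mulr1 -{1}uv; ring.
have ea : e * a = r%:C * f by rewrite -[RHS]mulr1 -e1 /a; ring.
have eaa : e * a ^+ 2 = (r ^+ 2)%:C * g.
  by rewrite expr2 mulrA ea /a /g rmorphXn /=; ring.
have fa : f * a = r%:C * g by rewrite /a /g; ring.
pose y1 := a *: x + C x; pose y2 := a *: x - C x.
pose v := a ^+ 2 *: x - C (C x).
have CD u w : C (u + w) = C u + C w by exact: linearD.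
have CB u w : C (u - w) = C u - C w by exact: linearB.
have CZ b u : C (b *: u) = b *: C u by exact: linearZ.
have y1v : a *: y1 - C y1 = v.
  by rewrite /y1 /v expr2 scalerDr CD CZ scalerA opprD addrA addrK.
have y2v : a *: y2 + C y2 = v.
  by rewrite /y2 /v expr2 scalerBr CB CZ scalerA addrA subrK.
have yv : e * a * (ip y1 v + ip y2 v) = 2 * (r ^+ 2)%:C * (e * ip x v).
  rewrite -innerDl addrACA subrr addr0 -scalerDl innerZl rmorphD -aa.
  by ring.
have y1E : complex.Re (e * a * ip y1 v)
    = r * (r * complex.Re g * nrm y1 ^+ 2 - complex.Re (f * ip y1 (C y1))).
  rewrite -y1v innerDr innerNr innerZr (inner_nrm hdot) ea.
  rewrite (_ : r%:C * f * _ = r%:C * (f * a * (nrm y1 ^+ 2)%:C - f * ip y1 (C y1))); last by ring.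
  rewrite fa; case: (g) => ? ?; case: (f * _) => ? ? /=; ring.
have y2E : complex.Re (e * a * ip y2 v)
    = r * (r * complex.Re g * nrm y2 ^+ 2 + complex.Re (f * ip y2 (C y2))).
  rewrite -y2v innerDr innerZr (inner_nrm hdot) ea.
  rewrite (_ : r%:C * f * _ = r%:C * (f * a * (nrm y2 ^+ 2)%:C + f * ip y2 (C y2))); last by ring.
  rewrite fa; case: (g) => ? ?; case: (f * _) => ? ? /=; ring.
have xE : complex.Re (2 * (r ^+ 2)%:C * (e * ip x v))
    = 2 * r ^+ 2 * (r ^+ 2 * complex.Re g * nrm x ^+ 2 - complex.Re (e * ip x (C (C x)))).
  rewrite innerDr innerNr innerZr (inner_nrm hdot) mulrBr mulrA eaa.
  case: (g) => ? ?; case: (e * _) => ? ? /=; ring.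
(* Both terms are nonnegative: [Cf] at [y1] and [CNf] at [y2] bound the forms by [k], and [kr] gives
   [k <= r Re g]. *)
have sum_ge0 : 0 <= complex.Re (e * a * (ip y1 v + ip y2 v)).
  rewrite mulrDr raddfD/= y1E y2E -mulrDr; apply: mulr_ge0; first exact: ltW.
  have := Cf y1; have := CNf y2; rewrite mulNr.
  have := ler_wpM2r (sqr_ge0 (nrm y1)) kr; have := ler_wpM2r (sqr_ge0 (nrm y2)) kr.
  case: (f * ip y2 _) => ? ? /=; lra.
move: sum_ge0; rewrite yv xE pmulr_rge0 ?subr_ge0//.
by rewrite mulr_gt0// exprn_gt0.
Qed.

(** The maximum is the support function of the convex hull of 1 and the disc of radius [s]. The
    radius is free because squaring asks for [0 < s], while [sin alpha] may be 0. *)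
Definition petal_range (C : H -> H) (s : R) :=
  forall e, unitary e -> support_le C e (Num.max (complex.Re e) s).

Lemma unitary_sqrt (z : R[i]) : unitary z ->
  exists f : R[i], [/\ unitary f, f ^+ 2 = z & complex.Re f ^+ 2 = (1 + complex.Re z) / 2].
Proof.
move=> uz; have := sqr_sqrtc z; move: (sqrtc z) => f fz; exists f.
move: uz; rewrite -fz; case: (f) => u v; rewrite /unitary/= => h.
have uv : u ^+ 2 + v ^+ 2 = 1.
  have : (u ^+ 2 + v ^+ 2) ^+ 2 = 1 by rewrite -h; ring.
  by move=> /eqP; rewrite sqrp_eq1 ?addr_ge0 ?sqr_ge0// => /eqP.
by split; rewrite //= -[X in X + _]uv; field.
Qed.

(** If [Re e >= s], take [f = e] and [r = 1]. Otherwise take [f] with [|Re f| <= s], so that both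
    half-planes have bound [s], and with [rho = Re (f^2 / e) >= s]; then [r = s / rho] gives
    [r^2 rho = s^2 / rho <= s]. *)
Lemma petal_range_square (C : {linear H -> H}) (s : R) : 0 < s < 1 ->
  petal_range C s -> petal_range (C \o C) s.
Proof.
move=> /andP[s0 s1] Cs e ue.
have uN f : unitary f -> unitary (- f).
  by case: f => u v; rewrite /unitary/= !sqrrN.
have ReN (f : R[i]) : complex.Re (- f) = - complex.Re f by case: f.
have [se|es] := leP s (complex.Re e).
  have eE : e ^+ 2 * e^*%C = e by rewrite expr2 -mulrA unitary_conj ?mulr1.
  apply: (@support_le_trans _ _ (1 ^+ 2 * complex.Re (e ^+ 2 * e^*%C))).
    by rewrite eE expr1n mul1r.
  apply: (@square_support_le _ _ _ _ (complex.Re e)) => //.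
  - by rewrite eE mul1r.
  - by apply: support_le_trans (Cs e ue); rewrite ge_max lexx.
  - apply: support_le_trans (Cs _ (uN _ ue)); rewrite ge_max se andbT ReN; lra.
suff [f [uf fs sf]] : exists f : R[i], [/\ unitary f, complex.Re f ^+ 2 <= s ^+ 2
    & s <= complex.Re (f ^+ 2 * e^*%C)].
  set rho := complex.Re _ in sf.
  have rho0 : 0 < rho by exact: lt_le_trans sf.
  have : `|complex.Re f| <= s by rewrite -(@ler_pXn2r _ 2)// ?nnegrE ?(ltW s0)// real_normK ?num_real.
  rewrite ler_norml => /andP[f1 f2].
  apply: (@support_le_trans _ _ ((s / rho) ^+ 2 * rho)).
    rewrite [leLHS](_ : _ = s * (s / rho)); last by field; rewrite gt_eqF.
    by rewrite ler_piMr ?(ltW s0)// ler_pdivrMr// mul1r.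
  apply: (@square_support_le _ _ _ _ s) => //.
  - by rewrite divr_gt0.
  - by rewrite divfK ?gt_eqF.
  - by apply: support_le_trans (Cs f uf); rewrite ge_max lexx f2.
  - by apply: support_le_trans (Cs _ (uN _ uf)); rewrite ge_max lexx ReN andbT lerNl.
move: ue es; case: e => p q; rewrite /unitary/= => pq ps.
(* For [Re e <= - s] the choice [f = i] works. Otherwise [f^2 = e (s + i c')] with [c'^2 = 1 - s^2]
   and [c'] of the sign of [q]: then [rho = s], and [q c' >= 1 - s^2] with [p < s] gives
   [(Re f)^2 <= s^2]. *)
have [ps'|ps'] := leP p (- s).
  exists 'i%C; split; rewrite /unitary/= ?expr0n ?expr1n ?add0r ?sqr_ge0//; lra.
have s2 : 0 <= 1 - s ^+ 2 by rewrite subr_ge0 expr_le1// ltW.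
pose c := Num.sqrt (1 - s ^+ 2).
have c2 : c ^+ 2 = 1 - s ^+ 2 by rewrite sqr_sqrtr.
have c0 : 0 <= c by exact: sqrtr_ge0.
have [c' c'2 qc] : exists2 c', c' ^+ 2 = c ^+ 2 & c ^+ 2 <= q * c'.
  have p2 : p ^+ 2 <= s ^+ 2 by rewrite -subr_ge0 subr_sqr mulr_ge0; lra.
  have cq : c ^+ 2 <= q ^+ 2 by rewrite c2; lra.
  have {}cq : c <= `|q| by rewrite -(@ler_pXn2r _ 2)// ?nnegrE// real_normK ?num_real.
  have [q0|q0] := leP 0 q.
    by exists c => //; rewrite expr2 ler_wpM2r//; move: cq; rewrite ger0_norm.
  exists (- c); first by rewrite sqrrN.
  by rewrite mulrN -mulNr expr2 ler_wpM2r//; move: cq; rewrite ltr0_norm.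
have [|f [uf fE f2]] := @unitary_sqrt ((p +i* q)%C * (s +i* c')%C).
  rewrite /unitary/=.
  rewrite (_ : _ + _ = (p ^+ 2 + q ^+ 2) * (s ^+ 2 + c' ^+ 2)); last by ring.
  by rewrite pq c'2 c2; ring.
exists f; split => //; first by rewrite f2/=; nra.
rewrite fE /= (_ : _ - _ = (p ^+ 2 + q ^+ 2) * s); last by ring.
by rewrite pq mul1r.
Qed.

End NumericalRange.

(** * Sectors in the complex plane *)

Section Geometry.
Set Implicit Arguments.
Unset Strict Implicit.
Local Open Scope classical_set_scope.
Local Open Scope ring_scope.
Context {R : realType}.
Variable alpha : R.
Hypothesis alpha_bound : 0 <= alpha <= pi / 4.

(** The bound [pi / 4] is used in full for [sin alpha <= cos alpha], that is
    [cos (2 alpha) >= 0]. *)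
Lemma sin_cos_sector :
  [/\ 0 <= sin alpha, sin alpha < 1, sin alpha <= cos alpha & 0 < cos alpha].
Proof.
have [a0 a4] := andP alpha_bound; have pi0 := pi_gt0 R.
have c0 : 0 < cos alpha by rewrite cos_gt0_pihalf//; apply/andP; split; lra.
have s0 : 0 <= sin alpha by rewrite sin_ge0_pi//; apply/andP; split; lra.
have sc : sin alpha <= cos alpha.
  have : 0 <= cos (alpha + alpha) by rewrite cos_ge0_pihalf//; apply/andP; split; lra.
  by rewrite cosD subr_ge0 -!expr2 ler_pXn2r// nnegrE// ltW.
split=> //.
rewrite ltNge; apply/negP => s1; have := cos2Dsin2 alpha.
have : 0 < cos alpha ^+ 2 by rewrite exprn_gt0.
have : 1 <= sin alpha ^+ 2 by rewrite exprn_ege1.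
lra.
Qed.

(** For [z != 0], [sin alpha Re z - cos alpha |Im z| = |z| sin (alpha - |arg z|)]. *)
Lemma sectorP (z : R[i]) : sector alpha z <->
  0 <= complex.Re z /\ cos alpha * `|complex.Im z| <= sin alpha * complex.Re z.
Proof.
have [s0 _ _ c0] := sin_cos_sector.
have [a0 a4] := andP alpha_bound; have pi0 := pi_gt0 R.
have [->|z0] := eqVneq z 0.
  by split=> [_|_]; [split; rewrite /= ?normr0 ?mulr0|left].
have [argl argu zE] := cargP z0.
have n0 : 0 < complex.Re `|z|.
  have : 0 < `|z| by rewrite normr_gt0.
  by case: (`|z|) => a b; rewrite ltcE /= => /andP[].
have nE : `|z| = (complex.Re `|z|)%:C by rewrite RRe_real// ger0_real.
have ReE : complex.Re z = complex.Re `|z| * cos (carg z).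
  by rewrite {1}zE nE /= mul0r subr0.
have ImE : complex.Im z = complex.Re `|z| * sin (carg z).
  by rewrite {1}zE nE /= mul0r addr0.
have subE : sin alpha * complex.Re z - cos alpha * `|complex.Im z|
    = complex.Re `|z| * sin (alpha - `|carg z|).
  rewrite ReE ImE normrM (gtr0_norm n0) sinB cos_norm.
  have -> : sin `|carg z| = `|sin (carg z)|.
    have [arg0|arg0] := leP 0 (carg z).
      by rewrite !ger0_norm// sin_ge0_pi// arg0.
    have sinN0 : 0 <= sin (- carg z) by rewrite sin_ge0_pi//; apply/andP; split; lra.
    by rewrite ltr0_norm// sinN ler0_norm// -oppr_ge0 -sinN.
  ring.
split=> [[/eqP|az]|[Re0 le_z]].
- by rewrite (negbTE z0).
- split; first by rewrite ReE pmulr_rge0// ltW// cos_gt0_pihalf//; move: az; rewrite ler_norml => /andP[h1 h2]; apply/andP; split; lra.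
  rewrite -subr_ge0 subE pmulr_rge0// sin_ge0_pi//.
  by have := normr_ge0 (carg z); move: az => h1 h2; apply/andP; split; lra.
right; rewrite /= leNgt; apply/negP => az.
have phi_pi : `|carg z| <= pi by rewrite ler_norml argu ltW.
have : 0 <= sin (alpha - `|carg z|) by rewrite -(pmulr_rge0 _ n0) -subE subr_ge0.
rewrite -opprB sinN oppr_ge0 leNgt; case/negP.
(* The sine could vanish outside the sector only for [|arg z| = pi], which [Re z >= 0] excludes. *)
have [lt_pi|ge_pi] := ltP (`|carg z| - alpha) pi.
  by rewrite sin_gt0_pi// subr_gt0 az.
have phiE : `|carg z| = pi by lra.
by move: Re0; rewrite ReE -cos_norm phiE cospi; lra.
Qed.

(** Outside the disc, the direction of the conjugate of [z] yields [|z|^2 <= Re z], and the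
    directions [sin alpha +- i cos alpha] yield the sector at 1. Then
    [|z - 1|^2 <= 1 - |z|^2 <= cos^2 alpha]. *)
Lemma quasi_sector_support (z : R[i]) :
  (forall e, unitary e -> complex.Re (e * z) <= Num.max (complex.Re e) (sin alpha)) ->
  quasi_sector alpha z.
Proof.
have [s0 s1 sc c0] := sin_cos_sector; have sc1 := cos2Dsin2 alpha.
case: z => x y supp.
pose rho := Num.sqrt (x ^+ 2 + y ^+ 2).
have rho_ge0 : 0 <= rho by exact: sqrtr_ge0.
have rho2 : rho ^+ 2 = x ^+ 2 + y ^+ 2 by rewrite sqr_sqrtr ?addr_ge0 ?sqr_ge0.
have [rho_s|s_rho] := leP rho (sin alpha); first by left; rewrite /= normc_def lecR.
right.
have rho0 : 0 < rho by exact: le_lt_trans s_rho.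
have rho_x : rho ^+ 2 <= x.
  have /supp : unitary ((x / rho) +i* (- y / rho))%C.
    by rewrite /unitary/= !expr_div_n sqrrN -mulrDl -rho2 divff// expf_neq0 ?gt_eqF.
  move=> /=; rewrite [leLHS](_ : _ = rho); last first.
    rewrite [LHS](_ : _ = (x ^+ 2 + y ^+ 2) / rho); last by ring.
    by rewrite -rho2 expr2 mulfK ?gt_eqF.
  by rewrite le_max (leNgt rho (sin _)) s_rho orbF ler_pdivlMr.
have x1 : x <= 1 by have := sqr_ge0 y; nra.
have s2 : sin alpha ^+ 2 <= rho ^+ 2 by rewrite ler_pXn2r// ?nnegrE// ltW.
split.
  apply/sectorP; split=> /=; first by lra.
  have [c' c'2 c'y] : exists2 c', c' ^+ 2 = cos alpha ^+ 2 & c' * y = - (cos alpha * `|y|).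
    have [y0|y0] := leP 0 y.
      by exists (- cos alpha); rewrite ?sqrrN// mulNr ger0_norm.
    by exists (cos alpha); rewrite // ltr0_norm// mulrN opprK.
  have /supp : unitary (sin alpha +i* c')%C by rewrite /unitary/= c'2; lra.
  by rewrite /= maxxx c'y sub0r normrN opprK mulrBr mulr1 lerBrDl.
suff : `|(x +i* y)%C - 1| <= (cos alpha)%:C by [].
rewrite normc_def lecR -(@ler_pXn2r _ 2)// ?nnegrE ?sqrtr_ge0 ?(ltW c0)//.
rewrite sqr_sqrtr ?addr_ge0 ?sqr_ge0//= oppr0 addr0; lra.
Qed.

End Geometry.

(** * Semigroups of sectorial operators *)

Section SectorialSemigroup.
Set Implicit Arguments.
Unset Strict Implicit.
Local Open Scope classical_set_scope.
Local Open Scope ring_scope.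
Context {R : realType} {H : completeNormedModType R[i]}.
Variable dot : {dot H for Num.conj}.
Hypothesis hdot : hilbert_norm dot.
Local Notation ip := (inner dot).

(** With [p = cos theta], [|q| = sin theta], [s = sin alpha], [c = cos alpha] this reads
    [cos (theta - alpha) <= sin (2 alpha)]: [p < s] means [theta - alpha > pi / 2 - 2 alpha], and
    the latter is nonnegative as [s <= c]. *)
Lemma petal_half_angle (s c p q : R) :
  0 <= s -> s <= c -> 0 < c -> c ^+ 2 + s ^+ 2 = 1 -> p ^+ 2 + q ^+ 2 = 1 -> p < s ->
  p * c + `|q| * s <= 2 * s * c.
Proof.
move=> s0 sc c0 cs pq ps; have q0 := normr_ge0 q.
have {}pq : p ^+ 2 + `|q| ^+ 2 = 1 by rewrite real_normK ?num_real.
move: (`|q|) q0 pq => r r0 pr.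
have [rc|cr] := leP r c; first by nra.
have E : (r - c) * (r + c) = (s - p) * (s + p) by lra.
have p_s : - s < p by rewrite ltNge; apply/negP => ?; nra.
have h : s * (r - c) * (r + c) <= c * (s - p) * (r + c).
  rewrite -!mulrA E.
  have h1 : s * (s + p) <= c * (r + c) by nra.
  have : 0 <= s - p by lra.
  nra.
have rc0 : 0 < r + c by lra.
by move: h; rewrite ler_pM2r//; lra.
Qed.

(* For [x = v + w] with [w = t A v], [ip x v] is the value of the resolvent [(1 + t A)^-1] at [x]. *)
Lemma resolvent_support (s c : R) (v w : H) (e : R[i]) :
  0 <= s -> s <= c -> 0 < c -> c ^+ 2 + s ^+ 2 = 1 ->
  0 <= complex.Re (ip v w) -> c * `|complex.Im (ip v w)| <= s * complex.Re (ip v w) ->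
  unitary e ->
  complex.Re (e * ip (v + w) v) <= Num.max (complex.Re e) s * nrm (v + w) ^+ 2.
Proof.
move=> s0 sc c0 cs; rewrite innerDl (inner_nrm hdot) (innerC dot v w) (nrmD_sqr hdot).
case: (ip v w) => b1 b2 /=; case: e => p q; rewrite /unitary/= => b10 b2s pq.
have V0 := sqr_ge0 (nrm v); have W0 := sqr_ge0 (nrm w).
move: (nrm v ^+ 2) (nrm w ^+ 2) V0 W0 => V W V0 W0.
have qb : q * b2 <= `|q| * `|b2| by rewrite -normrM ler_norm.
have q0 := normr_ge0 q; have b20 := normr_ge0 b2.
rewrite add0r mulrN opprK.
(* For [p >= s] one has [|q| <= c], and the sector condition gives [|q b2| <= s b1 <= p b1]. For
   [p < s], [petal_half_angle] times [b1] gives [p b1 + |q b2| <= 2 s b1]. *)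
have [sp|ps] := leP s p.
  have qc : `|q| <= c.
    rewrite -(@ler_pXn2r _ 2)// ?nnegrE ?(ltW c0)// real_normK ?num_real//; nra.
  have : `|q| * `|b2| <= s * b1 by apply: le_trans b2s; rewrite ler_wpM2r.
  nra.
have := petal_half_angle s0 sc c0 cs pq ps => half.
have : c * (p * b1 + `|q| * `|b2|) <= c * (2 * s * b1).
  have : `|q| * (c * `|b2|) <= `|q| * (s * b1) by rewrite ler_wpM2l.
  have := ler_wpM2l b10 half; lra.
rewrite ler_pM2l//; nra.
Qed.

Variables (alpha : R) (A : operator H).
Hypothesis alpha_bound : 0 <= alpha <= pi / 4.
Hypothesis A_sect : m_sectorial dot alpha A.

Lemma sectorial_dom u : op_dom A u ->
  0 <= complex.Re (ip u (A u)) /\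
  cos alpha * `|complex.Im (ip u (A u))| <= sin alpha * complex.Re (ip u (A u)).
Proof.
move=> Au; have [->|u0] := eqVneq u 0.
  have -> : ip 0 (A 0) = 0 by rewrite op_zero -(scale0r (0 : H)) innerZr mul0r.
  by rewrite /= normr0 !mulr0.
have [[_ numA] _ _] := A_sect.
pose v := (nrm u)^-1%:C *: u.
have nu0 : 0 < nrm u.
  by rewrite lt_neqAle nrm_ge0 andbT eq_sym; apply: contra u0 => /eqP/nrm0_eq0 ->.
have Av : op_dom A v by exact: op_dom_scale.
have /(sectorP alpha_bound) : sector alpha (ip v (A v)).
  by apply: numA; exists v => //; split => //; rewrite nrmE nrm_unit.
have -> : ip v (A v) = ((nrm u)^-1 ^+ 2)%:C * ip u (A u).
  by rewrite op_scale// innerZl innerZr mulrA rmorphXn /= oppr0.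
have k0 : 0 < (nrm u)^-1 ^+ 2 by rewrite exprn_gt0// invr_gt0.
move: (_ ^+ 2) k0 => k k0; case: (ip u (A u)) => a b /=.
rewrite !mul0r subr0 addr0 normrM gtr0_norm// pmulr_rge0//.
by rewrite mulrCA (mulrCA (sin alpha)) ler_pM2l.
Qed.

Lemma sectorial_expansive (t : R) x : 0 <= t -> op_dom A x ->
  nrm x <= nrm (x + t%:C *: A x).
Proof.
move=> t0 Ax; have [Re0 _] := sectorial_dom Ax.
rewrite -(@ler_pXn2r _ 2)// ?nnegrE ?nrm_ge0// (nrmD_sqr hdot) innerZr.
have : 0 <= t * complex.Re (ip x (A x)) by exact: mulr_ge0.
have := sqr_ge0 (nrm (t%:C *: A x)).
case: (ip x _) => a b /=; rewrite mul0r subr0; lra.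
Qed.

(* A point off the sector is separated from it by a half-plane [Re (e z) < 0] which contains the negative axis. *)
Lemma sector_separation z : ~ sector alpha z ->
  exists e : R[i], [/\ 0 < complex.Re e, complex.Re (e * z) < 0 &
    forall b : R[i], sector alpha b -> 0 <= complex.Re (e * b)].
Proof.
have [s0 _ _ c0] := sin_cos_sector alpha_bound.
rewrite (sectorP alpha_bound); case: z => x y /= zS.
have [x0|x0] := ltP x 0.
  exists 1; split=> [||b /(sectorP alpha_bound)[]].
  - exact: ltr01.
  - by rewrite mul1r.
  - by rewrite mul1r.
have cs : sin alpha * x < cos alpha * `|y| by rewrite ltNge; apply/negP => ?; apply: zS.
(* The normal to the sector edge facing [z] is tilted by [k > 0], making [Re e > 0] even for
   [alpha = 0]; [k (x + 1)] is half the gap, so [z] stays strictly on the other side. *)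
pose k := (cos alpha * `|y| - sin alpha * x) / 2 / (x + 1).
have x1 : 0 < x + 1 by lra.
have k0 : 0 < k by rewrite !divr_gt0// subr_gt0.
have kx : k * (x + 1) = (cos alpha * `|y| - sin alpha * x) / 2 by rewrite divfK// gt_eqF.
have [c' c'y c'n] : exists2 c', c' * y = cos alpha * `|y| & `|c'| = cos alpha.
  have [y0|y0] := leP 0 y.
    by exists (cos alpha); rewrite ger0_norm// ltW.
  exists (- cos alpha); first by rewrite mulNr ltr0_norm// mulrN.
  by rewrite normrN ger0_norm// ltW.
exists ((sin alpha + k) +i* c')%C; split=> /=; first by lra.
  by rewrite c'y; nra.
move=> [a b] /(sectorP alpha_bound)[/= a0 ba].
have : c' * b <= cos alpha * `|b| by rewrite -c'n -normrM ler_norm.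
nra.
Qed.

(** The resolvent point [z] and [- 1 / t] lie in a common half-plane off the sector, along which
    surjectivity propagates. *)
Lemma sectorial_onto (t : R) y : 0 < t ->
  exists2 x, op_dom A x & x + t%:C *: A x = y.
Proof.
move=> t0; have [_ _ [z zS [S [_ SA _]]]] := A_sect.
have [e [e0 ez eS]] := sector_separation zS.
have eA u : op_dom A u -> 0 <= complex.Re (e * ip u (A u)).
  by move=> Au; apply: eS; apply/(sectorP alpha_bound); exact: sectorial_dom.
have zA : shift_onto A z by move=> v; have [? ?] := SA v; exists (S v).
have eN : complex.Re (e * (- t^-1)%:C) < 0.
  by move: e0; case: (e) => p q /= p0; rewrite mulr0 subr0 mulrN oppr_lt0 mulr_gt0// invr_gt0.
have [x Ax xE] := shift_onto_half_plane hdot eA zA ez eN ((- t^-1)%:C *: y).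
exists x => //.
have : (- t)%:C *: ((- t^-1)%:C *: x - A x) = (- t)%:C *: ((- t^-1)%:C *: y) by rewrite xE.
rewrite scalerBr !scalerA -!rmorphM mulrNN divff ?gt_eqF// !scale1r => <-.
by rewrite rmorphN scaleNr opprK.
Qed.

Lemma sectorial_dense : dense (op_dom A).
Proof. by have [[]] := A_sect. Qed.

Variable F : R -> {linear H -> H}.
Hypothesis F0 : forall x, F 0 x = x.
Hypothesis FP : forall t x, 0 < t -> op_dom A (F t x) /\ F t x + t%:C *: A (F t x) = x.

Lemma euler_petal (t s : R) : 0 <= t -> sin alpha <= s -> petal_range dot (F t) s.
Proof.
move=> t0 les e ue.
have [s0 _ sc c0] := sin_cos_sector alpha_bound; have cs := cos2Dsin2 alpha.
apply: (@support_le_trans _ _ dot _ _ (Num.max (complex.Re e) (sin alpha))).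
  by rewrite ge_max !le_max lexx les !orbT.
move=> x; have [w [xE Re0 Im_le]] : exists w, [/\ F t x + w = x,
    0 <= complex.Re (ip (F t x) w) &
    cos alpha * `|complex.Im (ip (F t x) w)| <= sin alpha * complex.Re (ip (F t x) w)].
  move: t0; rewrite le_eqVlt => /predU1P[<-|t0].
    exists 0; rewrite F0 addr0; split => //; rewrite -(scale0r (0 : H)) innerZr mul0r //=.
    by rewrite normr0 !mulr0.
  have [AF xE] := FP x t0; exists (t%:C *: A (F t x)); rewrite innerZr.
  have [] := sectorial_dom AF; case: (ip _ _) => a b /=.
  rewrite !mul0r subr0 addr0 normrM gtr0_norm// pmulr_rge0// => a0 ab.
  by split => //; rewrite mulrCA (mulrCA (sin alpha)) ler_pM2l.
by rewrite -{1 3}xE; exact: (@resolvent_support _ (cos alpha)).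
Qed.

(** The exponent [2^n] amounts to [n] squarings; the linear map [D] carries the iterate through the
    induction. *)
Lemma iter_petal (C : {linear H -> H}) (s : R) n : 0 < s < 1 ->
  petal_range dot C s -> petal_range dot (iter (2 ^ n) C) s.
Proof.
move=> s01 Cs.
suff [D [DE Ds]] : exists D : {linear H -> H},
    (forall x, D x = iter (2 ^ n) C x) /\ petal_range dot D s.
  by move=> e ue x; rewrite -DE; exact: Ds.
elim: n => [|n [D [DE Ds]]]; first by exists C.
exists (D \o D : {linear H -> H}); split; last exact: petal_range_square.
by move=> x; rewrite /= !DE -iterD addnn -mul2n -expnS.
Qed.

Variable U : R -> {linear H -> H}.
Hypothesis UP : forall t x, 0 <= t -> euler_iter F n t x @[n --> \oo] --> U t x.

Lemma limit_petal (t s : R) : 0 <= t -> sin alpha < s < 1 -> petal_range dot (U t) s.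
Proof.
move=> t0 /andP[ls s1] e ue x.
have [s0 _ _ _] := sin_cos_sector alpha_bound.
set k := Num.max _ _.
have Un n : complex.Re (e * ip x (euler_iter F n t x)) <= k * nrm x ^+ 2.
  apply: iter_petal => //; first by rewrite s1 (le_lt_trans s0).
  by apply: euler_petal; [exact: half_pow_ge0|exact: ltW].
(* An approximant within [d / c] of [U t x] changes the form by at most [d]; the added 1 keeps [c]
   positive. *)
pose c := complex.Re `|e| * nrm x + 1.
have c0 : 0 < c.
  by rewrite ltr_wpDl// mulr_ge0 ?nrm_ge0// normc_def sqrtr_ge0.
apply/ler_addgt0Pr => d d0.
have /nrm_cvgP/(_ (d / c)) [|N _ /(_ N (leqnn N))/= NP] := @UP t x t0.
  by rewrite divr_gt0.
have -> : e * ip x (U t x) = e * ip x (euler_iter F N t x) + e * ip x (U t x - euler_iter F N t x).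
  by rewrite -mulrDr -innerDr addrC subrK.
rewrite raddfD/=; apply: lerD; first exact: Un.
apply: le_trans (Re_mul_inner_le hdot _ _ _) _.
rewrite nrmC mulrA; move: NP; rewrite ltr_pdivlMr//.
have := nrm_ge0 (euler_iter F N t x - U t x); rewrite /c; set n := nrm (_ - _); lra.
Qed.

Lemma limit_quasi_sectorial t : 0 <= t -> quasi_sectorial_contraction dot alpha (U t).
Proof.
move=> t0; have [s0 s1 _ _] := sin_cos_sector alpha_bound.
split=> [x|z [u [_ u1]] <-].
  rewrite nrm_le; exact: (limit_contractive sectorial_expansive F0 FP UP).
apply: (quasi_sector_support alpha_bound) => e ue.
apply/ler_addgt0Pr => d d0.
(* A radius strictly between [sin alpha] and 1, within [d] of [sin alpha]; the excess is absorbed as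
   [d] tends to 0. *)
pose s := Num.min (sin alpha + d) ((sin alpha + 1) / 2).
have [sd s_half] : s <= sin alpha + d /\ s <= (sin alpha + 1) / 2.
  by rewrite !ge_min !lexx orbT.
have ls : sin alpha < s by rewrite lt_min; apply/andP; split; lra.
have /= := @limit_petal t s t0 _ e ue u.
have -> : nrm u = 1 by rewrite /nrm u1.
rewrite expr1n mulr1 => h; apply: le_trans (h _) _; first by rewrite ls/=; lra.
have h1 : complex.Re e <= Num.max (complex.Re e) (sin alpha) by rewrite le_max lexx.
have h2 : sin alpha <= Num.max (complex.Re e) (sin alpha) by rewrite le_max lexx orbT.
by rewrite ge_max; apply/andP; split; lra.
Qed.

End SectorialSemigroup.

Theorem theorem2p1 (R : realType) (H : completeNormedModType R[i])
    (dot : {dot H for Num.conj}) (hdot : hilbert_norm dot) (hsep : separable H)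
    (alpha : R) (halpha : 0 <= alpha <= pi / 4) (A : operator H)
    (hA : m_sectorial dot alpha A) :
  (exists U : R -> {linear H -> H},
      C0_semigroup U /\ generates (opp_op A) U) /\
  (forall U : R -> {linear H -> H},
      C0_semigroup U -> generates (opp_op A) U ->
      forall t : R, 0 <= t -> quasi_sectorial_contraction dot alpha (U t)).
Proof.
have A_exp := sectorial_expansive hdot halpha hA.
have A_onto := sectorial_onto hdot halpha hA.
have A_dense := sectorial_dense hA.
have [F [F0 FP]] := euler_exists A_exp A_onto.
have [U UP] := euler_limit_exists A_exp A_dense F0 FP.
have cU := limit_C0_semigroup A_exp A_dense F0 FP UP.
have GU := limit_generates A_exp A_onto A_dense F0 FP UP.
split; first by exists U.
move=> V cV GV t t0.
(* By uniqueness any semigroup generated by [- A] is the Euler limit, so the estimates for [U]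
   transfer to [V]. *)
have VU x : V t x = U t x.
  apply: (generates_unique _ cU _ GU cV GV) => // s s0.
  exact: (limit_contractive A_exp F0 FP UP s0).
have [Uc Unum] := limit_quasi_sectorial hdot halpha hA F0 FP UP t0.
split=> [x|z [u u1 <-]]; first by rewrite VU.
by rewrite /= VU; apply: Unum; exists u.
Qed.
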